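(* Let $(L,A)$ be a Lie pair over a smooth manifold $M$ and let $E\to M$ be an $A$-module. Then the jet bundle $\mathcal{J}_{L/A}(E)$ is naturally an $A$-module, i.e. the formula $\nabla_a(D,e)=(\nabla_aD,\nabla_ae)$ given in the context defines a flat $A$-connection on $\mathcal{J}_{L/A}(E)$; and it fits in a short exact sequence of $A$-modules $$0\to A^\perp\otimes E\xrightarrow{\ \breve f\ }\mathcal{J}_{L/A}(E)\xrightarrow{\ \breve g\ }E\to 0 ,$$ where $A^\perp\subset L^*$ denotes the annihilator of $A$ in $L^*$ and $\breve f,\breve g$ are the bundle maps described in the context.
   Context: Lie algebroids and vector bundles are smooth, real or complex (in the complex case the anchor takes values in $T_M\otimes\mathbb{C}$ and functions and linear maps are over $\mathbb{C}$; write $\mathbb{K}=\mathbb{R}$ or $\mathbb{C}$ for the scalars). $\rho$ denotes the anchor and $\rho^*$ its transpose. A Lie pair $(L,A)$ is a Lie algebroid $L\to M$ together with a Lie subalgebroid $A$ of $L$ over the same base $M$. An $L$-connection on $E$ is a $\mathbb{K}$-bilinear map $\Gamma(L)\times\Gamma(E)\to\Gamma(E)$, $(l,e)\mapsto\nabla_le$, with $\nabla_{fl}e=f\nabla_le$ and $\nabla_l(fe)=\rho(l)(f)\,e+f\nabla_le$; it is flat if $\nabla_{l_1}\nabla_{l_2}-\nabla_{l_2}\nabla_{l_1}=\nabla_{[l_1,l_2]}$. An $A$-module is a vector bundle with a flat $A$-connection (the $A$-action). A morphism of $A$-modules is a bundle map over $\mathrm{id}_M$ commuting with the connections. The quotient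 $L/A$ is an $A$-module via $\nabla_a(q(l))=q([a,l])$, where $q:L\to L/A$ is the projection; $A^\perp\cong(L/A)^*$ carries the dual action, $E^*$ the dual action $\langle\nabla_a\varepsilon,e\rangle=\rho(a)\langle\varepsilon,e\rangle-\langle\varepsilon,\nabla_ae\rangle$, and $A^\perp\otimes E$ the tensor product action. Jet bundle: the fibre of $\mathcal{J}_{L/A}(E)$ over $x\in M$ is the vector space of pairs $(D_x,e_x)$, where $e_x\in E_x$ and $D_x:\Gamma(E^* )\to L_x^*$ is $\mathbb{K}$-linear, such that for all $a_x\in A_x$, $\varepsilon\in\Gamma(E^* )$, $f\in C^\infty(M)$: $$\langle D_x(\varepsilon),a_x\rangle=\langle\nabla_{a_x}\varepsilon,e_x\rangle,\qquad D_x(f\varepsilon)=f(x)D_x(\varepsilon)+\langle\varepsilon_x,e_x\rangle\,\rho^*(df)_x .$$ (Equivalently, these are the linear maps $\phi:L_x\to T_{e_x}E$ lifting the anchor $\rho:L_x\to T_xM$ and agreeing on $A_x$ with the horizontal lift of the $A$-action at $e_x$; the correspondence is $\langle D_x(\varepsilon),l\rangle=\phi(l)(f_\varepsilon)$, with $f_\varepsilon$ the fibrewise linear function on $E$ defined by $\varepsilon$.) A section of $\mathcal{J}_{L/A}(E)$ is thus a pair $(D,e)$ with $e\in\Gamma(E)$ and $D:\Gamma(E^* )\to\Gamma(L^* )$ linear satisfying $\langle D(\varepsilon),a\rangle=\langle\nabla_a\varepsilon,e\rangle$ and $D(f\varepsilon)=fD(\varepsilon)+\langle\varepsilon,e\rangle\rho^*(df)$.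 The $A$-action: $\nabla_a(D,e)=(\nabla_aD,\nabla_ae)$ where, for $a\in\Gamma(A)$, $\varepsilon\in\Gamma(E^* )$, $l\in\Gamma(L)$, $$\langle(\nabla_aD)(\varepsilon),l\rangle=\rho(a)\langle D(\varepsilon),l\rangle-\langle D(\nabla_a\varepsilon),l\rangle-\langle D(\varepsilon),[a,l]\rangle .$$ Maps: $\breve g(D_x,e_x)=e_x$; and $\breve f(\psi)=(\psi^\dagger,0_x)$ for $\psi\in(A^\perp\otimes E)_x$, viewed as a linear map $L_x\to E_x$ vanishing on $A_x$, where $\langle\psi^\dagger(\varepsilon),l_x\rangle=\langle\varepsilon_x,\psi(l_x)\rangle$. *)

(* Defs.v *)
From HB Require Import structures.
From mathcomp Require Import all_boot all_order all_algebra.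
From mathcomp Require Import complex.
From mathcomp Require Import boolp classical_sets functions reals topology.
From mathcomp Require Import normedtype landau derive.

Set Implicit Arguments.
Unset Strict Implicit.
Unset Printing Implicit Defensive.
Import GRing.Theory Num.Theory.
Import numFieldNormedType.Exports.
Local Open Scope classical_set_scope.
Local Open Scope ring_scope.

Section Smooth.
Variables (R : realType) (V : normedModType R).
Implicit Types (U : set V) (f g : V -> R).

(* For U open, f is of class C^k on U: differentiable, with directional
   derivatives of class C^(k-1). *)
Fixpoint Ck (k : nat) U f : Prop :=
  match k with
  | 0 => forall x, U x -> {for x, continuous f}
  | k'.+1 => (forall x, U x -> differentiable f x) /\
             (forall v : V, Ck k' U ('D_v f))
  end.

Definition smooth U f := forall k, Ck k U f.

Lemma Ck_ext k U f g : open U -> (forall x, U x -> f x = g x) ->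
  Ck k U f -> Ck k U g.
Proof.
have nearE W (h1 h2 : V -> R) x : open W -> (forall x, W x -> h1 x = h2 x) ->
    W x -> \near x, h1 x = h2 x :> R.
  move=> oW e Wx; near=> y; apply: e.
  by near: y; exact: open_nbhs_nbhs.
move=> oU; elim: k f g => [|k IH] f g fg /=.
  move=> cf x Ux; rewrite /prop_for /continuous_at -(fg x Ux).
  apply: cvg_trans (cf x Ux); apply: near_eq_cvg.
  exact: nearE Ux.
move=> [df Df]; split.
  move=> x Ux; have [cdf Edf] := (diff_locallyP _ _).1 (df x Ux).
  have E : g \o shift x = cst (g x) + 'd f x +o_ 0 id.
    apply/eqaddoP => e e0; have := (eqaddoP _ _ _ _).1 Edf e e0.
    have : \forall y \near (0 : V), f (y + x) = g (y + x).
      by move: (nearE _ _ _ _ oU fg Ux); rewrite (near_shift 0) subr0.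
    move=> /[swap]; apply: filterS2 => y.
    by move=> + fgy; rewrite !fctE /= -(fg x Ux) fgy.
  by apply/diff_locallyP; rewrite (diff_unique cdf E).
move=> v; apply: IH (Df v) => x Ux.
apply/near_eq_derive; exact: nearE Ux.
Unshelve. all: by end_near. Qed.

Lemma CkW k U W f : U `<=` W -> Ck k W f -> Ck k U f.
Proof.
move=> UW; elim: k f => [|k IH] f /=; first by move=> cf x /UW; exact: cf.
by move=> [df Df]; split => [x /UW|v]; [exact: df | exact: IH].
Qed.

Lemma Ck_prec k U f : Ck k.+1 U f -> Ck k U f.
Proof.
elim: k f => [|k IH] f; first by move=> [df _] x /df; exact: differentiable_continuous.
by move=> [df Df]; split => // v; exact/IH/Df.
Qed.

Lemma Ck_cst k U (c : R) : Ck k U (cst c).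
Proof.
elim: k c => [|k IH] c /=; first by move=> x _; exact: cst_continuous.
split=> [x _|v]; first exact: differentiable_cst.
rewrite (_ : 'D_v (cst c) = cst 0); first exact: IH.
by apply/funext => x; rewrite derive_cst.
Qed.

Lemma CkD k U f g : open U -> Ck k U f -> Ck k U g -> Ck k U (f \+ g).
Proof.
move=> oU; elim: k f g => [|k IH] f g /=.
  by move=> cf cg x Ux; apply: continuousD; [exact: cf | exact: cg].
move=> [df Df] [dg Dg]; split=> [x Ux|v].
  by apply: differentiableD; [exact: df | exact: dg].
apply: (Ck_ext oU _ (IH _ _ (Df v) (Dg v))) => x Ux.
by rewrite -[in RHS]/(f + g) deriveD //; apply: diff_derivable; [exact: df | exact: dg].
Qed.

Lemma CkM k U f g : open U -> Ck k U f -> Ck k U g -> Ck k U (f \* g).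
Proof.
move=> oU; elim: k f g => [|k IH] f g.
  by move=> cf cg x Ux; apply: continuousM; [exact: cf | exact: cg].
move=> Cf Cg; have [[df Df] [dg Dg]] := (Cf, Cg); split=> [x Ux|v].
  by apply: differentiableM; [exact: df | exact: dg].
have H := CkD oU (IH _ _ (Ck_prec Cf) (Dg v)) (IH _ _ (Ck_prec Cg) (Df v)).
apply: (Ck_ext oU _ H) => x Ux.
by rewrite -[in RHS]/(f * g) deriveM //; apply: diff_derivable; [exact: df | exact: dg].
Qed.

End Smooth.

Inductive scalars := RealScalars | ComplexScalars.

Definition scal (R : realType) (k : scalars) : fieldType :=
  match k with RealScalars => R | ComplexScalars => R[i] end.

Definition re_part (R : realType) (k : scalars) : scal R k -> R :=
  match k return scal R k -> R with
  | RealScalars => fun z => z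
  | ComplexScalars => fun z => complex.Re z
  end.

Definition im_part (R : realType) (k : scalars) : scal R k -> R :=
  match k return scal R k -> R with
  | RealScalars => fun=> 0
  | ComplexScalars => fun z => complex.Im z
  end.

(* chart_map and chart_inv are total functions, only meaningful on chart_dom and
   on its image. *)
Record chart (R : realType) (M : topologicalType) (n : nat) := Chart {
  chart_dom : set M;
  chart_map : M -> 'rV[R]_n;
  chart_inv : 'rV[R]_n -> M;
  chart_dom_open : open chart_dom;
  chart_im_open : open (chart_map @` chart_dom);
  chart_invK : forall x, chart_dom x -> chart_inv (chart_map x) = x;
  chart_map_cont : forall x, chart_dom x -> {for x, continuous chart_map};
  chart_inv_cont :
    forall y, (chart_map @` chart_dom) y -> {for y, continuous chart_inv} }.

Definition smooth_transition (R : realType) (M : topologicalType) (n : nat)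
    (c d : chart R M n) :=
  forall i, smooth (chart_map c @` (chart_dom c `&` chart_dom d))
                   (fun y => chart_map d (chart_inv c y) ord0 i).

Record manifold (R : realType) := Manifold {
  mcarrier :> topologicalType;
  mdim : nat;
  atlas : set (chart R mcarrier mdim);
  atlas_cover : forall x, exists2 c, atlas c & chart_dom c x;
  atlas_compat : forall c d, atlas c -> atlas d -> smooth_transition c d;
  mhausdorff : hausdorff_space mcarrier;
  mcountable : @second_countable mcarrier }.

Lemma chart_image_open (R : realType) (M : topologicalType) (n : nat)
  (c : chart R M n) (U : set M) : open U -> open (chart_map c @` (U `&` chart_dom c)).
Proof.
move=> oU; rewrite openE => _ [x [Ux cx] <-].
have imx : (chart_map c @` chart_dom c) (chart_map c x) by exists x.
have oW : open (U `&` chart_dom c) by apply: openI => //; exact: chart_dom_open.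
have Wx : nbhs (chart_inv c (chart_map c x)) (U `&` chart_dom c).
  by rewrite chart_invK //; exact: open_nbhs_nbhs.
have N1 := chart_inv_cont imx Wx.
have N2 := open_nbhs_nbhs (conj (@chart_im_open _ _ _ c) imx).
have N1' : \forall y \near chart_map c x, (U `&` chart_dom c) (chart_inv c y).
  exact: N1.
near=> y; have Wy : (U `&` chart_dom c) (chart_inv c y) by near: y.
have [z cz zy] : (chart_map c @` chart_dom c) y by near: y.
by exists z => //; move: Wy; rewrite -zy chart_invK.
Unshelve. all: by end_near. Qed.

Section SmoothFunctions.
Variables (R : realType) (k : scalars) (M : manifold R).
Local Notation K := (scal R k).
Implicit Types (U : set M).

Definition smooth_real U (f : M -> R) :=
  forall c, @atlas R M c ->
    smooth (chart_map c @` (U `&` chart_dom c)) (f \o chart_inv c).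

Definition smooth_fun U (f : M -> K) :=
  smooth_real U (@re_part R k \o f) /\ smooth_real U (@im_part R k \o f).

Lemma smooth_realW U W f : U `<=` W -> smooth_real W f -> smooth_real U f.
Proof.
move=> UW sf c ac j; apply: CkW (sf c ac j).
by apply: image_subset; apply: setSI.
Qed.

Lemma smooth_funW U W f : U `<=` W -> smooth_fun W f -> smooth_fun U f.
Proof. by move=> UW [? ?]; split; apply: smooth_realW UW _. Qed.

Lemma smooth_real_cst U (z : R) : smooth_real U (fun=> z).
Proof. by move=> c ac j; exact: Ck_cst. Qed.

Lemma smooth_realD U f g : open U ->
  smooth_real U f -> smooth_real U g -> smooth_real U (f \+ g).
Proof.
move=> oU sf sg c ac j; apply: (CkD _ (sf c ac j) (sg c ac j)).
exact: chart_image_open.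
Qed.

Lemma smooth_realM U f g : open U ->
  smooth_real U f -> smooth_real U g -> smooth_real U (f \* g).
Proof.
move=> oU sf sg c ac j; apply: (CkM _ (sf c ac j) (sg c ac j)).
exact: chart_image_open.
Qed.

Lemma smooth_realN U f : open U -> smooth_real U f -> smooth_real U (\- f).
Proof.
move=> oU sf; have := smooth_realM oU (smooth_real_cst U (-1)) sf.
by congr smooth_real; apply/funext => x; rewrite /= mulN1r.
Qed.

Lemma smooth_fun_cst U (z : K) : smooth_fun U (fun=> z).
Proof. by split; exact: smooth_real_cst. Qed.

Lemma smooth_funD U f g : open U ->
  smooth_fun U f -> smooth_fun U g -> smooth_fun U (fun x => f x + g x).
Proof.
move=> oU [rf jf] [rg jg]; split.
  have := smooth_realD oU rf rg; congr smooth_real; apply/funext => x /=.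
  by case: (k) f g {rf jf rg jg} => //= f g; case: (f x) (g x) => ? ? [].
have := smooth_realD oU jf jg; congr smooth_real; apply/funext => x /=.
case: (k) f g {rf jf rg jg} => /= f g; first by rewrite addr0.
by case: (f x) (g x) => ? ? [].
Qed.

Lemma smooth_funM U f g : open U ->
  smooth_fun U f -> smooth_fun U g -> smooth_fun U (fun x => f x * g x).
Proof.
move=> oU [rf jf] [rg jg]; split.
  have := smooth_realD oU (smooth_realM oU rf rg)
            (smooth_realN oU (smooth_realM oU jf jg)).
  congr smooth_real; apply/funext => x /=.
  case: (k) f g {rf jf rg jg} => /= f g; first by rewrite mulr0 subr0.
  by case: (f x) (g x) => ? ? [].
have := smooth_realD oU (smooth_realM oU rf jg) (smooth_realM oU jf rg).
congr smooth_real; apply/funext => x /=.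
case: (k) f g {rf jf rg jg} => /= f g; first by rewrite mulr0 mul0r addr0.
by case: (f x) (g x) => ? ? [].
Qed.

End SmoothFunctions.

Section LinearMaps.
Variables (K : fieldType) (V W : lmodType K).

Record lin := Lin { lin_fun :> V -> W; lin_subproof : `[< linear lin_fun >] }.

HB.instance Definition _ := [isSub for lin_fun].
HB.instance Definition _ := [Choice of lin by <:].

Lemma lin_submod_closed : submod_closed [pred f : V -> W | `[< linear f >]].
Proof.
split=> [|c f g]; rewrite !inE.
  by move=> a u v; rewrite /= scaler0 addr0.
move=> lf lg a u v.
rewrite -[LHS]/(c *: f (a *: u + v) + g (a *: u + v)).
rewrite -[RHS]/(a *: (c *: f u + g u) + (c *: f v + g v)).
by rewrite lf lg !scalerDr !scalerA mulrC addrACA.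
Qed.
HB.instance Definition _ :=
  GRing.SubChoice_isSubLmodule.Build K (V -> W) _ lin lin_submod_closed.

HB.instance Definition _ (f : lin) :=
  GRing.isLinear.Build K V W _ (lin_fun f) (asboolW (lin_subproof f)).

End LinearMaps.

(* Linear maps V -> W killing the image of i : S -> V; for injective i this is
   Hom(V / S, W). *)
Section AnnihilatingMaps.
Variables (K : fieldType) (S V : lmodType K) (i : lin S V) (W : lmodType K).

Record ahom := AHom {
  ahom_lin :> lin V W; ahom_subproof : `[< forall a, ahom_lin (i a) = 0 >] }.

HB.instance Definition _ := [isSub for ahom_lin].
HB.instance Definition _ := [Choice of ahom by <:].

Lemma ahom_submod_closed :
  submod_closed [pred f : lin V W | `[< forall a, f (i a) = 0 >]].
Proof.
split=> [|c f g]; rewrite !inE; first by [].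
move=> lf lg a.
by rewrite -[LHS]/(c *: f (i a) + g (i a)) lf lg scaler0 addr0.
Qed.
HB.instance Definition _ :=
  GRing.SubChoice_isSubLmodule.Build K (lin V W) _ ahom ahom_submod_closed.

End AnnihilatingMaps.

Definition psec (K : fieldType) (M : Type) (F : M -> lmodType K) := forall x, F x.
Identity Coercion psec_fun : psec >-> Funclass.

Section Psec.
Variables (K : fieldType) (M : Type) (F : M -> lmodType K).
Implicit Types s t : psec F.

HB.instance Definition _ := gen_eqMixin (psec F).
HB.instance Definition _ := gen_choiceMixin (psec F).

Let padd s t : psec F := fun x => s x + t x.
Let popp s : psec F := fun x => - s x.
Let pzero : psec F := fun x => 0.
Let pscale (c : K) s : psec F := fun x => c *: s x.
Let paddA : associative padd.
Proof. by move=> s t u; apply: functional_extensionality_dep => x; exact: addrA. Qed.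
Let paddC : commutative padd.
Proof. by move=> s t; apply: functional_extensionality_dep => x; exact: addrC. Qed.
Let padd0 : left_id pzero padd.
Proof. by move=> s; apply: functional_extensionality_dep => x; exact: add0r. Qed.
Let paddN : left_inverse pzero popp padd.
Proof. by move=> s; apply: functional_extensionality_dep => x; exact: addNr. Qed.
HB.instance Definition _ :=
  GRing.isZmodule.Build (psec F) paddA paddC padd0 paddN.
Let pscaleA c d s : pscale c (pscale d s) = pscale (c * d) s.
Proof. by apply: functional_extensionality_dep => x; exact: scalerA. Qed.
Let pscale1 : left_id 1 pscale.
Proof. by move=> s; apply: functional_extensionality_dep => x; exact: scale1r. Qed.
Let pscaleDr : right_distributive pscale +%R.
Proof. by move=> c s t; apply: functional_extensionality_dep => x; exact: scalerDr. Qed.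
Let pscaleDl s : {morph pscale^~ s : c d / c + d}.
Proof. by move=> c d; apply: functional_extensionality_dep => x; exact: scalerDl. Qed.
HB.instance Definition _ :=
  GRing.Zmodule_isLmodule.Build K (psec F) pscaleA pscale1 pscaleDr pscaleDl.

End Psec.

Section Families.
Variables (R : realType) (k : scalars) (M : manifold R).
Local Notation K := (scal R k).

(* A family of vector spaces with, over each open set U, its smooth sections.
   A section over U is represented by a section over M, of which only the values
   on U matter. *)
Record family := Family {
  fib :> M -> lmodType K;
  secs : set M -> set (psec fib);
  secsW : forall U W s, open U -> U `<=` W -> secs W s -> secs U s;
  secs0 : forall U, open U -> secs U 0;
  secsD : forall U s t, open U -> secs U s -> secs U t -> secs U (s + t);
  secsZ : forall U f s, open U -> smooth_fun U f -> secs U s ->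
    secs U (fun x => f x *: s x) }.

Record frame (F : family) := Frame {
  frame_dom : set M;
  frame_rank : nat;
  frame_vec : 'I_frame_rank -> psec F;
  frame_open : open frame_dom;
  frame_smooth : forall i, secs frame_dom (frame_vec i);
  frame_basis : forall x, frame_dom x -> forall v : F x,
    exists! c : 'rV[K]_frame_rank, v = \sum_i c ord0 i *: frame_vec i x }.

Definition smooth_coords (F : family) (U : set M) (s : psec F) (e : frame F) :=
  exists c : 'I_(frame_rank e) -> M -> K,
    (forall i, smooth_fun (U `&` frame_dom e) (c i)) /\
    (forall x, (U `&` frame_dom e) x -> s x = \sum_i c i x *: frame_vec i x).

(* A vector bundle: M is covered by local frames, and the smooth sections are
   those with smooth coordinates in these frames.  As the frames themselves are
   smooth, the changes of frames are. *)
Definition locally_trivial (F : family) := exists B : set (frame F),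
  (forall x, exists2 e, B e & frame_dom e x) /\
  (forall U s, open U ->
    (secs U s <-> forall e, B e -> smooth_coords U s e)).

Section Sections.
Variable F : family.

Record Gamma := MkGamma {
  sec_fun :> psec F; Gamma_subproof : `[< secs [set: M] sec_fun >] }.

HB.instance Definition _ := [isSub for sec_fun].
HB.instance Definition _ := [Choice of Gamma by <:].

Lemma GammaP (s : Gamma) : secs [set: M] s.
Proof. exact: asboolW (Gamma_subproof s). Qed.

Lemma Gamma_submod_closed :
  submod_closed [pred s : psec F | `[< secs [set: M] s >]].
Proof.
split=> [|c s t]; rewrite !inE; first by apply: secs0; exact: openT.
move=> ss st; apply: secsD => //.
  exact: openT.
by apply: (@secsZ F _ (fun=> c)) => //; [exact: openT | exact: smooth_fun_cst].
Qed.
HB.instance Definition _ :=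
  GRing.SubChoice_isSubLmodule.Build K (psec F) _ Gamma Gamma_submod_closed.

Definition mk_sec (s : psec F) (ss : secs [set: M] s) : Gamma :=
  MkGamma (asboolT ss).

End Sections.

(* The trivial line bundle; its sections are the smooth functions. *)
Program Definition triv : family :=
  @Family (fun=> K^o) (fun U f => @smooth_fun R k M U f) _ _ _ _.
Next Obligation. by move=> U W s _; exact: smooth_funW. Qed.
Next Obligation. by move=> U _; exact: smooth_fun_cst. Qed.
Next Obligation. by move=> U s t oU ss st; exact: smooth_funD. Qed.
Next Obligation. by move=> U f s oU sf ss; exact: smooth_funM. Qed.

Definition Cinf := Gamma triv.

Program Definition fscale (F : family) (f : Cinf) (s : Gamma F) : Gamma F :=
  @mk_sec F (fun x => f x *: s x) _.
Next Obligation.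
move=> F f s; apply: secsZ; [exact: openT | exact: (GammaP f) | exact: GammaP].
Qed.

Program Definition Hom (F G : family) : family :=
  @Family (fun x => lin (F x) (G x))
    (fun U h => forall V s, open V -> V `<=` U -> secs V s ->
       secs V (fun x => h x (s x)))
    _ _ _ _.
Next Obligation.
by move=> F G U W h _ UW sh V s oV VU; apply: sh => //; exact: subset_trans VU UW.
Qed.
Next Obligation. by move=> F G U _ V s oV _ _; exact: secs0. Qed.
Next Obligation.
by move=> F G U h h' oU sh sh' V s oV VU ss; apply: secsD => //; [exact: sh | exact: sh'].
Qed.
Next Obligation.
move=> F G U f h oU sf sh V s oV VU ss; apply: secsZ => //; last exact: sh.
exact: smooth_funW VU sf.
Qed.

Definition dual (F : family) := Hom F triv.

Program Definition happly (F G : family) (h : Gamma (Hom F G)) (s : Gamma F) :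
  Gamma G := @mk_sec G (fun x => h x (s x)) _.
Next Obligation.
by move=> F G h s; apply: (GammaP h) => //; [exact: openT | exact: GammaP].
Qed.

(* Bundle maps over the identity of M. *)
Record bmap (F G : family) := BMap {
  bm_fun :> forall x, lin (F x) (G x);
  bm_smooth : forall U s, open U -> secs U s -> secs U (fun x => bm_fun x (s x)) }.

Program Definition bm_sec (F G : family) (h : bmap F G) (s : Gamma F) : Gamma G :=
  @mk_sec G (fun x => h x (s x)) _.
Next Obligation.
by move=> F G h s; apply: bm_smooth; [exact: openT | exact: GammaP].
Qed.

(* Tangent vectors at x are the point derivations of the K-valued smooth
   functions; over the complex scalars this is the complexified tangent space. *)
Definition derivation_at (x : M) (v : Cinf -> K^o) :=
  linear v /\ forall f g : Cinf, v (fscale f g) = f x * v g + g x * v f.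

Section TangentSpace.
Variable x : M.

Record tangent := Tangent {
  tan_fun :> Cinf -> K^o; tan_subproof : `[< derivation_at x tan_fun >] }.

HB.instance Definition _ := [isSub for tan_fun].
HB.instance Definition _ := [Choice of tangent by <:].

Lemma tangent_submod_closed :
  submod_closed [pred v : Cinf -> K^o | `[< derivation_at x v >]].
Proof.
split=> [|c v w]; rewrite !inE.
  split=> [a f g|f g]; first by rewrite /= scaler0 addr0.
  by rewrite /= !mulr0 addr0.
move=> [lv dv] [lw dw]; split=> [a f g|f g].
  rewrite -[LHS]/(c *: v (a *: f + g) + w (a *: f + g)).
  rewrite -[RHS]/(a *: (c *: v f + w f) + (c *: v g + w g)).
  by rewrite lv lw !scalerDr !scalerA mulrC addrACA.
rewrite -[LHS]/(c * v (fscale f g) + w (fscale f g)).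
rewrite -[RHS]/(f x * (c * v g + w g) + g x * (c * v f + w f)).
by rewrite dv dw !mulrDr !(mulrCA c) addrACA.
Qed.
HB.instance Definition _ := GRing.SubChoice_isSubLmodule.Build
  K (Cinf -> K^o) _ tangent tangent_submod_closed.

End TangentSpace.

Program Definition TM : family :=
  @Family tangent
    (fun U X => forall f : Cinf, smooth_fun U (fun x => X x f : K)) _ _ _ _.
Next Obligation. by move=> U W X _ UW sX f; exact: smooth_funW UW (sX f). Qed.
Next Obligation. by move=> U _ f; exact: smooth_fun_cst. Qed.
Next Obligation.
by move=> U X Y oU sX sY f; exact: (smooth_funD oU (sX f) (sY f)).
Qed.
Next Obligation.
by move=> U f X oU sf sX g; exact: (smooth_funM oU sf (sX g)).
Qed.

Program Definition vf_apply (X : Gamma TM) (f : Cinf) : Cinf :=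
  @mk_sec triv (fun x => X x f) _.
Next Obligation. by move=> X f; exact: (GammaP X). Qed.

End Families.

Section LieAlgebroids.
Variables (R : realType) (k : scalars) (M : manifold R).
Local Notation K := (scal R k).
Local Notation family := (family k M).
Local Notation Cinf := (Cinf k M).
Local Notation triv := (triv k M).

Record lie_algebroid := LieAlgebroid {
  la_fam :> family;
  la_loc : locally_trivial la_fam;
  anchor : bmap la_fam (TM k M);
  bracket : Gamma la_fam -> Gamma la_fam -> Gamma la_fam;
  bracketDl : forall l, linear (bracket^~ l);
  bracketDr : forall l, linear (bracket l);
  bracket_alt : forall l, bracket l l = 0;
  bracket_jacobi : forall l m n,
    bracket l (bracket m n) + bracket m (bracket n l) + bracket n (bracket l m) = 0;
  bracket_leibniz : forall l m (f : Cinf),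
    bracket l (fscale f m) =
      fscale f (bracket l m) + fscale (vf_apply (bm_sec anchor l) f) m;
  anchor_bracket : forall l m (f : Cinf),
    vf_apply (bm_sec anchor (bracket l m)) f =
      vf_apply (bm_sec anchor l) (vf_apply (bm_sec anchor m) f)
      - vf_apply (bm_sec anchor m) (vf_apply (bm_sec anchor l) f) }.

(* The function rho(l)(f). *)
Definition rho (L : lie_algebroid) (l : Gamma L) (f : Cinf) : Cinf :=
  vf_apply (bm_sec (anchor L) l) f.

(* The value at x of rho^*(df). *)
Program Definition rho_star (L : lie_algebroid) (f : Cinf) (x : M) :
  dual L x := @Lin _ (L x) (K^o : lmodType K) (fun l => anchor L x l f) _.
Next Obligation.
by move=> L f x; apply: asboolT => a u v; rewrite linearP.
Qed.

Definition is_connection (L : lie_algebroid) (F : family)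
    (nabla : Gamma L -> Gamma F -> Gamma F) :=
  [/\ (forall e, linear (nabla^~ e)), (forall l, linear (nabla l)),
      (forall f l e, nabla (fscale f l) e = fscale f (nabla l e))
    & (forall f l e, nabla l (fscale f e) =
         fscale (rho l f) e + fscale f (nabla l e))].

Definition is_flat (L : lie_algebroid) (F : family)
    (nabla : Gamma L -> Gamma F -> Gamma F) :=
  forall l m e, nabla l (nabla m e) - nabla m (nabla l e) = nabla (bracket l m) e.

Definition is_module (L : lie_algebroid) (F : family)
    (nabla : Gamma L -> Gamma F -> Gamma F) :=
  [/\ locally_trivial F, is_connection nabla & is_flat nabla].

Record lie_module (L : lie_algebroid) := LieModule {
  lm_fam :> family;
  lm_conn : Gamma L -> Gamma lm_fam -> Gamma lm_fam;
  lm_module : is_module lm_conn }.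

Definition module_morphism (L : lie_algebroid) (F G : family)
    (nF : Gamma L -> Gamma F -> Gamma F) (nG : Gamma L -> Gamma G -> Gamma G)
    (h : bmap F G) :=
  forall l s, bm_sec h (nF l s) = nG l (bm_sec h s).

Definition short_exact (F G H : family) (f : bmap F G) (g : bmap G H) :=
  forall x, [/\ injective (f x),
                (forall v, g x v = 0 <-> exists u, f x u = v)
              & (forall w, exists v, g x v = w)].

(* A Lie subalgebroid over the same base, given by its inclusion. *)
Record lie_pair := LiePair {
  lp_L : lie_algebroid;
  lp_A : lie_algebroid;
  lp_inc : bmap lp_A lp_L;
  lp_inc_inj : forall x, injective (lp_inc x);
  lp_anchor : forall x a, anchor lp_L x (lp_inc x a) = anchor lp_A x a;
  lp_bracket : forall a b,
    bm_sec lp_inc (bracket a b) = bracket (bm_sec lp_inc a) (bm_sec lp_inc b) }.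

(* The dual action of an A-action on E is characterized by its pairing with the
   sections of E; xget picks the section of E^* so characterized. *)
Definition dual_conn (A : lie_algebroid) (E : lie_module A)
    (a : Gamma A) (eps : Gamma (dual E)) : Gamma (dual E) :=
  xget 0 [set eta : Gamma (dual E) | forall e : Gamma E,
    happly eta e = rho a (happly eps e) - happly eps (lm_conn a e)].

Section Pair.
Variable P : lie_pair.
Local Notation L := (lp_L P).
Local Notation A := (lp_A P).
Local Notation inc := (lp_inc P).

(* Hom(L/A, F), the linear maps L_x -> F_x vanishing on A_x. *)
Program Definition HomQ (F : family) : family :=
  @Family R k M (fun x => ahom (inc x) (F x))
    (fun U h => @secs _ _ _ (Hom L F) U (fun x => ahom_lin (h x))) _ _ _ _.
Next Obligation. by move=> F U W h oU UW sh; exact: (secsW oU UW sh). Qed.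
Next Obligation. by move=> F U oU; exact: secs0. Qed.
Next Obligation.
by move=> F U h h' oU sh sh'; apply: (secsD oU sh sh').
Qed.
Next Obligation.
by move=> F U f h oU sf sh; apply: (secsZ oU sf sh).
Qed.

Program Definition HomQ_inc (F : family) : bmap (HomQ F) (Hom L F) :=
  @BMap _ _ _ (HomQ F) (Hom L F)
    (fun x => @Lin _ _ _ (fun h : HomQ F x => ahom_lin h) _) _.
Next Obligation. by move=> F x; apply: asboolT => a u v. Qed.
Next Obligation. by move=> F U s oU ss. Qed.

Definition annihilator : family := HomQ triv.

(* The dual of the action nabla_a (q l) = q [a, l] on L/A. *)
Definition ann_conn (a : Gamma A) (alpha : Gamma annihilator) :
    Gamma annihilator :=
  xget 0 [set beta : Gamma annihilator | forall l : Gamma L,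
    happly (bm_sec (HomQ_inc triv) beta) l =
      rho a (happly (bm_sec (HomQ_inc triv) alpha) l)
      - happly (bm_sec (HomQ_inc triv) alpha) (bracket (bm_sec inc a) l)].

Variable E : lie_module A.

(* A^perp (x) E *)
Definition ann_tensor : family := HomQ E.

Program Definition tens (alpha : Gamma annihilator) (e : Gamma E) :
    Gamma ann_tensor :=
  @mk_sec _ _ _ ann_tensor
    (fun x => @AHom _ _ _ (inc x) (E x)
       (@Lin _ _ _ (fun l => (alpha x l : K) *: e x) _) _) _.
Next Obligation.
by move=> alpha e x; apply: asboolT => c u v; rewrite linearP scalerDl scalerA.
Qed.
Next Obligation.
move=> alpha e x; apply: asboolT => a /=.
by rewrite (asboolW (ahom_subproof (alpha x))) scale0r.
Qed.
Next Obligation.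
move=> alpha e V s oV VT ss; apply: secsZ => //; first exact: (GammaP alpha).
exact: secsW oV VT (GammaP e).
Qed.

(* Every a_x in A_x is the value at x of some section a of A, and (nabla_a eps)_x
   depends on a_x only. *)
Definition is_jet (x : M) (p : (Gamma (dual E) -> dual L x) * E x) :=
  [/\ linear p.1,
      (forall (a : Gamma A) eps, p.1 eps (inc x (a x)) = dual_conn a eps x p.2)
    & (forall f eps,
         p.1 (fscale f eps) = f x *: p.1 eps + (eps x p.2 : K) *: rho_star L f x)].

Section JetSpace.
Variable x : M.

Record jet := Jet {
  jet_val :> (Gamma (dual E) -> dual L x) * E x;
  jet_subproof : `[< is_jet jet_val >] }.

HB.instance Definition _ := [isSub for jet_val].
HB.instance Definition _ := [Choice of jet by <:].

Lemma jet_submod_closed : submod_closed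
  [pred p : (Gamma (dual E) -> dual L x) * E x | `[< is_jet p >]].
Proof.
split=> [|c [D e] [D' e']]; rewrite !inE.
  rewrite -[0]/((fun=> 0, 0) : (Gamma (dual E) -> dual L x) * E x).
  split=> [c u v|a eps|f eps] /=.
  - by rewrite scaler0 addr0.
  - by rewrite linear0.
  - by rewrite !linear0 scale0r addr0.
move=> [/= lp ap fp] [/= lq aq fq].
rewrite -[c *: _ + _]/((fun eps => c *: D eps + D' eps, c *: e + e') :
  (Gamma (dual E) -> dual L x) * E x).
split=> [d u v|a eps|f eps] /=.
- by rewrite lp lq !scalerDr !scalerA mulrC addrACA.
- rewrite -[LHS]/(c *: D eps (inc x (a x)) + D' eps (inc x (a x))).
  by rewrite ap aq -linearP.
have -> : eps x (c *: e + e') = c * (eps x e : K) + (eps x e' : K) :> K.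
  by rewrite linearP.
rewrite fp fq scalerDl !scalerDr !scalerA (mulrC c).
by rewrite addrACA.
Qed.
HB.instance Definition _ := GRing.SubChoice_isSubLmodule.Build
  K ((Gamma (dual E) -> dual L x) * E x)%type _ jet jet_submod_closed.

End JetSpace.

Definition jet_secs (U : set M) (u : psec (jet : M -> lmodType K)) : Prop :=
  @secs _ _ _ E U (fun x => (jet_val (u x)).2) /\
  forall eps, @secs _ _ _ (dual L) U (fun x => (jet_val (u x)).1 eps).

Program Definition jet_bundle : family := @Family R k M jet jet_secs _ _ _ _.
Next Obligation.
move=> U W u oU UW [su Du]; split=> [|eps]; first exact: (secsW oU UW su).
exact: (@secsW _ _ _ (dual L) _ _ _ oU UW (Du eps)).
Qed.
Next Obligation.
by move=> U oU; split=> [|eps]; [exact: secs0 | exact: (@secs0 _ _ _ (dual L))].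
Qed.
Next Obligation.
move=> U u v oU [su Du] [sv Dv]; split=> [|eps]; first exact: (secsD oU su sv).
exact: (@secsD _ _ _ (dual L) _ _ _ oU (Du eps) (Dv eps)).
Qed.
Next Obligation.
move=> U f u oU sf [su Du]; split=> [|eps]; first exact: (secsZ oU sf su).
exact: (@secsZ _ _ _ (dual L) _ _ _ oU sf (Du eps)).
Qed.

Program Definition breve_g : bmap jet_bundle E :=
  @BMap _ _ _ jet_bundle E
    (fun x => @Lin _ _ _ (fun u : jet_bundle x => (jet_val u).2) _) _.
Next Obligation. by move=> x; apply: asboolT. Qed.
Next Obligation. by move=> U s oU []. Qed.

(* psi^dagger(eps) is the linear form l |-> <eps, psi(l)>. *)
Program Definition dagger (x : M) (psi : ann_tensor x) (eps : Gamma (dual E)) :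
    dual L x :=
  @Lin _ (L x) (K^o : lmodType K) (fun l => eps x (psi l)) _.
Next Obligation.
by move=> x psi eps; apply: asboolT => c u v; rewrite !linearP.
Qed.

Program Definition breve_f : bmap ann_tensor jet_bundle :=
  @BMap _ _ _ ann_tensor jet_bundle
    (fun x => @Lin _ (ann_tensor x) (jet_bundle x)
       (fun psi => @Jet x (dagger psi, 0) _) _) _.
Next Obligation.
move=> x psi; apply: asboolT; split=> [c u v|a eps|f eps].
- exact/val_inj/funext.
- by rewrite /= (asboolW (ahom_subproof psi)) !linear0.
- by rewrite /= linear0 scale0r addr0; exact/val_inj/funext.
Qed.
Next Obligation.
move=> x; apply: asboolT => c psi psi'; apply: val_inj; congr pair => /=.
  apply/funext => eps; apply/val_inj/funext => l /=.
  by rewrite -[LHS]/(eps x (c *: psi l + psi' l)) linearP.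
by rewrite scaler0 addr0.
Qed.
Next Obligation.
move=> U psi oU spsi; split=> [|eps]; first exact: secs0.
move=> V l oV VU sl; apply: (GammaP eps V _ oV) => //.
exact: spsi.
Qed.

(* The components D(eps) and e of a section (D, e) of the jet bundle. *)
Definition jet_sec (u : Gamma jet_bundle) : Gamma E := bm_sec breve_g u.

Program Definition jet_D (u : Gamma jet_bundle) (eps : Gamma (dual E)) :
  Gamma (dual L) := @mk_sec _ _ _ (dual L) (fun x => (jet_val (u x)).1 eps) _.
Next Obligation. by move=> u eps; exact: ((GammaP u).2 eps). Qed.

Definition jet_action (nabla : Gamma A -> Gamma jet_bundle -> Gamma jet_bundle) :=
  forall a u,
    jet_sec (nabla a u) = lm_conn a (jet_sec u) /\
    forall (eps : Gamma (dual E)) (l : Gamma L),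
      happly (jet_D (nabla a u) eps) l =
        rho a (happly (jet_D u eps) l) - happly (jet_D u (dual_conn a eps)) l
        - happly (jet_D u eps) (bracket (bm_sec inc a) l).

(* The tensor product of the actions on A^perp and E is the connection given by
   the Leibniz rule on decomposable sections, which determines it. *)
Definition tensor_action
    (nabla : Gamma A -> Gamma ann_tensor -> Gamma ann_tensor) :=
  is_connection nabla /\
  forall a alpha e, nabla a (tens alpha e) =
    tens (ann_conn a alpha) e + tens alpha (lm_conn a e).

End Pair.
End LieAlgebroids.

(* Main.v *)
Require Import Defs.
From HB Require Import structures.
From mathcomp Require Import all_boot all_order all_algebra.
From mathcomp Require Import boolp classical_sets functions reals topology.
From mathcomp Require Import complex ring lra.
From mathcomp Require Import normedtype derive sequences realfun exp.

Set Implicit Arguments.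
Unset Strict Implicit.
Unset Printing Implicit Defensive.
Import Defs Order.TTheory GRing.Theory Num.Theory.
Import numFieldNormedType.Exports.
Local Open Scope classical_set_scope.
Local Open Scope ring_scope.

(** The formulas for the actions are algebraic identities between global
sections, and the algebra is short: over the smooth functions, each of them is
linear in the argument against which it is tested, and flatness comes from the
Jacobi identity, the flatness of E and the fact that the anchor preserves
brackets.  What carries the proof is the passage between such identities and the
fibrewise notions of jet, bundle map and vector bundle.

The passage rests on bump functions (bump_fun), built from t^-n exp(-1/t).  By
cutting off a local frame (e_i) of F and its dual frame (c_i), every point gets
global sections with phi v = sum_i c_i(v) e_i on all of M and phi = 1 near the
point (global_dual_frame).  Applied to an operator T on global sections which is
linear over the smooth functions, this expansion gives T(s)(x) = sum_i c_i(s(x))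
T(e_i)(x): such an operator is a bundle map (tensorial_Hom).  The dual action,
the action on A^perp, the action on A^perp (x) E = Hom(L/A, E) and the form
nabla_a D(eps) on L are all obtained in this way, since in each case the
derivative terms cancel.  A jet is determined by its pairings with global
sections (jet_ext), so the connection axioms, flatness and the compatibility of
the two maps with the actions become identities between smooth functions.

Exactness in the middle: a jet (D, 0) has D linear over the smooth functions, so
D(eps) = sum_i <eps, e_i> D(c_i), and (D, 0) is the image of
l |-> sum_i D(c_i)(l) e_i (breve_f_exact).  For the surjectivity of the
projection to E, a frame a_i of A is completed to a frame of L; if alpha_i are
the forms on L dual to the a_i, then l |-> sum_i alpha_i(l) nabla_{a_i} e is, near
the given point, an extension N of the A-action on e to L, and N yields the jet
D(eps)(l) = rho(l)<eps, e> - <eps, N(l)> (jet_of_partial_connection, jet_lift).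

Local triviality: a family of vector spaces whose sections glue, and which has
near each point smooth sections with a smooth dual basis, is a vector bundle
(locally_trivial_of_dual_frames).  If l_j completes the a_i to a frame of L, with
dual forms lambda_j, the sections lambda_j (x) e_m form a frame of A^perp (x) E
(tensor_dual_frame); their images together with jets lifting the e_m form a frame
of the jet bundle (jet_locally_trivial). *)

(** * Smooth functions flat at the origin of the line *)

Section FlatFunctions.
Variable R : realType.

(** The powers of 1/t make the family stable under differentiation, up to
linear combinations. *)
Definition flat (n : nat) (t : R) : R :=
  if 0 < t then t^-1 ^+ n * expR (- t^-1) else 0.

Lemma flat_ge0 n t : 0 <= flat n t.
Proof.
rewrite /flat; case: ifP => // t0.
by rewrite mulr_ge0 ?expR_ge0// exprn_ge0// invr_ge0 ltW.
Qed.

Lemma flat_gt0 n t : 0 < t -> 0 < flat n t.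
Proof.
by move=> t0; rewrite /flat t0 mulr_gt0 ?expR_gt0// exprn_gt0// invr_gt0.
Qed.

Lemma flat_le0 n t : t <= 0 -> flat n t = 0.
Proof. by move=> t0; rewrite /flat ltNge t0. Qed.

(** For t > 0 and s = 1/t this is s^(n+2) / (n+2)! <= exp s. *)
Lemma flat_leX n t : flat n t <= n.+2`!%:R * t ^+ 2.
Proof.
have [t0|t0] := ltP 0 t; last first.
  by rewrite flat_le0// mulr_ge0// sqr_ge0.
rewrite /flat t0; set s := t^-1.
have s0 : 0 < s by rewrite invr_gt0.
have -> : t = s^-1 by rewrite invrK.
rewrite expRN ler_pdivrMr ?expR_gt0//.
have f0 : (0 : R) < n.+2`!%:R by rewrite ltr0n fact_gt0.
have H : s ^+ n.+2 / n.+2`!%:R <= expR s.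
  by have := @expR_ge1Dxn R s n.+1 (ltW s0); lra.
have -> : s ^+ n = n.+2`!%:R * s^-1 ^+ 2 * (s ^+ n.+2 / n.+2`!%:R).
  by rewrite !exprS expr0; field; rewrite !lt0r_neq0.
apply: ler_wpM2l => //.
by rewrite mulr_ge0 ?(ltW f0)// exprn_ge0// invr_ge0 ltW.
Qed.

(** At the origin the difference quotient is O(t) by flat_leX. *)
Lemma is_derive_flat n (t : R) :
  is_derive t 1 (flat n) (flat n.+2 t - n%:R * flat n.+1 t).
Proof.
have [t0|t0|->] := ltgtP t 0.
- rewrite !flat_le0 ?ltW// mulr0 subr0.
  apply: (@near_eq_is_derive _ _ _ (cst 0)).
  near=> u; rewrite flat_le0//; apply: ltW; near: u; exact: lt_nbhsl.
- pose g : R -> R := (fun u => u^-1) ^+ n * (expR \o (fun u => - u^-1)).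
  have tn0 : t != 0 by rewrite gt_eqF.
  have dV : is_derive t 1 (fun u : R => u^-1) (- t ^- 2).
    by have := @is_deriveV _ id t 1 1 tn0 (is_derive_id _ _); rewrite [_ *: 1]mulr1.
  have dE : is_derive t 1 (expR \o (fun u : R => - u^-1)) (expR (- t^-1) * t ^- 2).
    apply: is_derive1_comp; rewrite -[t ^- 2]opprK; exact: is_deriveN.
  have : is_derive t 1 g (flat n.+2 t - n%:R * flat n.+1 t).
    have := is_deriveM (is_deriveX n dV) dE.
    rewrite -/g; congr is_derive.
    rewrite /flat t0 /= !fctE.
    rewrite -![_ *: _]/(_ * _).
    case: n {g} => [|n]; rewrite /= ?expr0 ?exprS; first by field.
    by move: (t^-1 ^+ n) => u; field.
  apply: (@near_eq_is_derive _ _ _ g (flat n)).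
  near=> u; rewrite /flat ifT.
    by rewrite /g !fctE.
  by near: u; apply: open_nbhs_nbhs; split => //; exact: open_gt.
- rewrite !flat_le0// mulr0 subr0.
  have H : (fun h => h^-1 *: ((flat n \o shift 0) (h *: 1) - flat n 0)) @ 0^'
      --> (0 : R).
    apply/cvgr0Pnorm_lt => e e0.
    near=> h.
    have h0 : h != 0 by near: h; exact: nbhs_dnbhs_neq.
    rewrite /= (flat_le0 _ (lexx 0)) subr0 addr0 [h *: 1]mulr1 normrM normfV.
    rewrite ltr_pdivrMl ?normr_gt0// (ger0_norm (flat_ge0 _ _)).
    apply: le_lt_trans (flat_leX _ _) _.
    rewrite -real_normK ?num_real// expr2 mulrCA ltr_pM2l ?normr_gt0//.
    rewrite -ltr_pdivlMl ?ltr0n ?fact_gt0//.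
    near: h; apply: dnbhs0_lt; rewrite mulr_gt0// invr_gt0 ltr0n fact_gt0//.
  by apply: DeriveDef; [exact: cvgP H | exact: cvg_lim H].
Unshelve. all: by end_near. Qed.

End FlatFunctions.

(** * Smooth functions on open sets of a normed space *)

Section Smooth.
Variables (R : realType) (V : normedModType R).
Implicit Types (U : set V) (f g : V -> R).

Lemma Ck_local k U f :
  (forall x, U x -> exists2 W, W x & Ck k W f) -> Ck k U f.
Proof.
elim: k f => [|k IH] f H /=; first by move=> x /H[W Wx]; exact.
split=> [x /H[W Wx [df _]]|v]; first exact: df.
by apply: IH => x /H[W Wx [_ Df]]; exists W => //; exact: Df.
Qed.

(** Induction on k through (1/f)' = - (1/f)^2 f'. *)
Lemma CkV k U f : open U -> (forall x, U x -> f x != 0) -> Ck k U f ->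
  Ck k U (fun x => (f x)^-1).
Proof.
move=> oU f0; elim: k => [|k IH] Cf.
  by move=> x Ux; apply: continuousV; [exact: f0 | exact: Cf].
have CV := IH (Ck_prec Cf); have [df Df] := Cf; split=> [x Ux|v].
  by apply: differentiableV; [exact: df | exact: f0].
have H := CkM oU (Ck_cst k U (-1)) (CkM oU (CkM oU CV CV) (Df v)).
apply: (Ck_ext oU _ H) => x Ux.
rewrite deriveV; [|exact: f0|by apply: diff_derivable; exact: df].
by rewrite /= -[RHS]/( _ * _) mulN1r mulNr expr2 invfM.
Qed.

(** The induction on k is for all n at once, because the derivative of flat n
involves flat n.+1 and flat n.+2. *)
Lemma Ck_flat k n U f : open U -> Ck k U f -> Ck k U (flat n \o f).
Proof.
move=> oU; elim: k n => [|k IH] n Cf.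
  move=> x Ux; apply: continuous_comp; first exact: Cf.
  apply: differentiable_continuous; apply/derivable1_diffP.
  by have [] := is_derive_flat n (f x).
have Cf' := Ck_prec Cf; have [df Df] := Cf.
have dflat t : differentiable (flat (R:=R) n) t.
  by apply/derivable1_diffP; have [] := is_derive_flat n t.
split=> [x Ux|v]; first by apply: differentiable_comp; [exact: df|].
have H := CkM oU (CkD oU (IH n.+2 Cf') (CkM oU (Ck_cst k U (- n%:R)) (IH n.+1 Cf')))
  (Df v).
apply: (Ck_ext oU _ H) => x Ux.
have dfx := df x Ux.
rewrite (deriveE _ (differentiable_comp dfx (dflat _))) (diff_comp dfx (dflat _)).
rewrite /= -(deriveE _ dfx) -[in RHS](mulr1 ('D_v f x)) -[in RHS]/(_ *: _).
rewrite linearZ -(deriveE _ (dflat _)).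
have /@derive_val -> := is_derive_flat n (f x).
by rewrite -[RHS]/(_ * _) mulNr mulrC.
Qed.

End Smooth.

(** * Real functions on a manifold, and bump functions *)

Section SmoothReal.
Variables (R : realType) (M : manifold R).
Implicit Types (U W : set M) (f g : M -> R).

Lemma smooth_real_local U f :
  (forall x, U x -> exists2 W, W x & smooth_real W f) -> smooth_real U f.
Proof.
move=> H c ac j; apply: Ck_local => _ [x [Ux cx] <-].
have [W Wx sf] := H x Ux.
by exists (chart_map c @` (W `&` chart_dom c)); [exists x | exact: sf].
Qed.

Lemma smooth_real_ext U f g : open U -> (forall x, U x -> f x = g x) ->
  smooth_real U f -> smooth_real U g.
Proof.
move=> oU fg sf c ac j; apply: Ck_ext (sf c ac j).
  exact: chart_image_open.
by move=> _ [x [Ux cx] <-]; rewrite /= chart_invK ?fg.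
Qed.

Lemma smooth_realV U f : open U -> (forall x, U x -> f x != 0) ->
  smooth_real U f -> smooth_real U (fun x => (f x)^-1).
Proof.
move=> oU f0 sf c ac j; apply: CkV (sf c ac j); first exact: chart_image_open.
by move=> _ [x [Ux cx] <-]; rewrite /= chart_invK ?f0.
Qed.

Lemma smooth_real_flat n U f : open U ->
  smooth_real U f -> smooth_real U (flat n \o f).
Proof.
move=> oU sf c ac j; apply: Ck_flat (sf c ac j); exact: chart_image_open.
Qed.

(** Read in another chart, a chart coordinate is a component of a transition map. *)
Lemma smooth_real_coord (c : chart R M (mdim M)) i : atlas c ->
  smooth_real (chart_dom c) (fun x => chart_map c x ord0 i).
Proof. by move=> ac d ad j; rewrite setIC; exact: (atlas_compat ad ac). Qed.

Lemma smooth_real_sum U (I : Type) (r : seq I) (F : I -> M -> R) : open U ->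
  (forall i, smooth_real U (F i)) -> smooth_real U (fun x => \sum_(i <- r) F i x).
Proof.
move=> oU sF; elim: r => [|i r IH].
  by apply: smooth_real_ext (smooth_real_cst U 0) => // x _; rewrite big_nil.
apply: smooth_real_ext (smooth_realD oU (sF i) IH) => // x _.
by rewrite big_cons.
Qed.

Lemma smooth_real_continuous U f x : open U -> U x -> smooth_real U f ->
  {for x, continuous f}.
Proof.
move=> oU Ux sf; have [c ac cx] := atlas_cover x.
have cf : {for chart_map c x, continuous (f \o chart_inv c)}.
  by apply: (sf c ac 0); exists x.
have : {for x, continuous ((f \o chart_inv c) \o chart_map c)}.
  by apply: continuous_comp => //; exact: chart_map_cont.
rewrite /prop_for /continuous_at /= chart_invK// => H.
apply: cvg_trans H; apply: near_eq_cvg.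
have : nbhs x (chart_dom c) by apply: open_nbhs_nbhs; split => //; exact: chart_dom_open.
by apply: filterS => y cy /=; rewrite chart_invK.
Qed.

(** Let q be the squared Euclidean distance to x in a chart.  The quotient
flat (r - q) / (flat (r - q) + flat (q - r / 4)) has a positive denominator, is 1
where q <= r / 4 and 0 where q >= r.  The ball q <= r is compact, so its image is
closed in M, which is Hausdorff, and the extension by 0 is smooth.  The set V is
the complement of that image: with U it covers M, which is what an extension by
zero of an object given over U requires. *)
Lemma bump_real x U : open U -> U x -> exists f : M -> R,
  [/\ smooth_real setT f, \forall y \near x, f y = 1
    & exists V, [/\ open V, (forall y, U y \/ V y) & forall y, V y -> f y = 0]].
Proof.
move=> oU Ux; have [c ac cx] := atlas_cover x.
pose y0 := chart_map c x.
pose D := U `&` chart_dom c.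
have oD : open D by apply: openI => //; exact: chart_dom_open.
have : nbhs y0 (chart_map c @` D).
  by apply: open_nbhs_nbhs; split; [exact: chart_image_open | exists x].
case/nbhs_ballP => e /= e0 be.
pose q (y : 'rV[R]_(mdim M)) : R := \sum_i (y ord0 i - y0 ord0 i) ^+ 2.
have q_lt (y : 'rV[R]_(mdim M)) i : `|y0 ord0 i - y ord0 i| ^+ 2 <= q y.
  rewrite /q (bigD1 i)//= distrC real_normK ?num_real// lerDl.
  by apply: sumr_ge0 => j _; exact: sqr_ge0.
(* A Euclidean ball of radius e / 2 lies in the sup-norm ball of radius e. *)
pose r := (e / 2) ^+ 2.
have r0 : 0 < r by rewrite exprn_gt0// divr_gt0.
have qball y : q y <= r -> ball y0 e y.
  move=> qr; split=> // i j; rewrite /ball /= ord1.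
  have := le_trans (q_lt y j) qr.
  rewrite ler_pXn2r ?nnegrE//; last by rewrite divr_ge0// ltW.
  by move=> /le_lt_trans; apply; rewrite ltr_pdivrMr// ltr_pMr// ltr1n.
have cq : continuous q.
  rewrite /q; elim: (index_enum _) => [|i s IH].
    rewrite (_ : (fun _ => _) = cst 0); first exact: cst_continuous.
    by apply/funext => y; rewrite big_nil.
  rewrite (_ : (fun _ => _) = (fun y : 'rV[R]_(mdim M) => (y ord0 i - y0 ord0 i) ^+ 2) \+
    (fun y => \sum_(i <- s) (y ord0 i - y0 ord0 i) ^+ 2)); last first.
    by apply/funext => y; rewrite big_cons.
  move=> y; apply: continuousD; last exact: IH.
  apply: (@continuous_comp _ _ _
    (fun y : 'rV[R]_(mdim M) => y ord0 i - y0 ord0 i) (fun t : R => t ^+ 2));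
    last exact: exprn_continuous.
  apply: continuousB; [exact: coord_continuous | exact: cst_continuous].
pose K := [set y | q y <= r].
have cK : compact K.
  apply: bounded_closed_compact.
    exists (`|y0| + e); split=> [|N yN y /qball]; first exact: num_real.
    rewrite -ball_normE /= => /ltW yle; apply: le_trans (ltW yN).
    by rewrite -[y](subKr y0) (le_trans (ler_normB _ _))// lerD2l.
  by apply: (preimage_closed _ (@closed_le _ r)) => y _; exact: cq.
have KD y : K y -> exists2 z, D z & chart_map c z = y.
  by move=> /qball/be.
pose S := chart_inv c @` K.
have cS : closed S.
  apply: compact_closed; first exact: mhausdorff.
  apply: continuous_compact cK; apply: continuous_in_subspaceT => y.
  rewrite inE => /KD[z [_ cz] <-]; apply: chart_inv_cont; by exists z.
pose B z := flat 0 (r - q (chart_map c z)).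
pose C z := flat 0 (q (chart_map c z) - r / 4).
pose g z := B z / (B z + C z).
have BC z : 0 < B z + C z.
  have [qr|qr] := ltP (q (chart_map c z)) r.
    by rewrite ltr_wpDr// ?flat_ge0// flat_gt0// subr_gt0.
  rewrite ltr_wpDl ?flat_ge0// flat_gt0//; lra.
have sq : smooth_real D (q \o chart_map c).
  apply: smooth_real_sum => // i.
  have H : smooth_real D (fun x => chart_map c x ord0 i - y0 ord0 i).
    apply: smooth_realD => //; last exact: smooth_real_cst.
    by apply: smooth_realW (smooth_real_coord i ac) => ? [].
  exact: smooth_realM.
have sB : smooth_real D B.
  apply: (@smooth_real_flat 0 D (fun z => r - q (chart_map c z))) => //.
  apply: smooth_realD => //; first exact: smooth_real_cst.
  exact: smooth_realN.
have sC : smooth_real D C.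
  apply: (@smooth_real_flat 0 D (fun z => q (chart_map c z) - r / 4)) => //.
  apply: smooth_realD => //; exact: smooth_real_cst.
have sg : smooth_real D g.
  apply: smooth_realM => //; apply: smooth_realV => //.
    by move=> z _; rewrite gt_eqF.
  exact: smooth_realD.
pose f z := if pselect (D z) then g z else 0.
have f0 y : (~` S) y -> f y = 0.
  move=> nS; rewrite /f; case: pselect => //= -[Uy cy].
  rewrite /g /B flat_le0 ?mul0r// subr_le0 leNgt; apply/negP => qr; apply: nS.
  by exists (chart_map c y); rewrite ?chart_invK// /K /= ltW.
have DS y : D y \/ (~` S) y.
  have [|nD] := pselect (D y); [by left | right => -[z /KD[u Du <-]]].
  by rewrite chart_invK => [uy|]; [rewrite uy in Du | case: Du].
exists f; split.
- apply: smooth_real_local => y _; case: (DS y) => [Dy|Sy].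
    exists D => //; apply: smooth_real_ext sg => // z Dz.
    by rewrite /f; case: pselect.
  exists (~` S) => //; apply: smooth_real_ext (smooth_real_cst _ 0).
    exact: closed_openC.
  by move=> z /f0.
- have : \forall y \near x, q (chart_map c y) < r / 4.
    have Cq : {for x, continuous (q \o chart_map c)}.
      apply: continuous_comp; [exact: chart_map_cont | exact: cq].
    apply: (Cq [set t | t < r / 4]); apply: open_nbhs_nbhs; split; first exact: open_lt.
    by rewrite /= /q big1 => [|i _]; [rewrite divr_gt0 | rewrite subrr expr0n].
  have nD : nbhs x D by apply: open_nbhs_nbhs.
  apply: filterS2 nD => y Dy qy; rewrite /f; case: pselect => //= _.
  rewrite /g {2}/B /C (@flat_le0 _ 0 (_ - r / 4)); last by rewrite subr_le0 ltW.
  rewrite addr0 divff//.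
  rewrite gt_eqF// flat_gt0// subr_gt0; lra.
- exists (~` S); split => //; first exact: closed_openC.
  by move=> y; case: (DS y) => [[]|]; [left|right].
Qed.

End SmoothReal.

(** * Scalar functions on a manifold *)

Section SmoothFun.
Variables (R : realType) (k : scalars) (M : manifold R).
Local Notation K := (scal R k).
Implicit Types (U W : set M) (f g : M -> K).

Definition scal_of_real : R -> K :=
  match k return R -> scal R k with
  | RealScalars => fun z => z
  | ComplexScalars => fun z => (z +i* 0)%C
  end.

(** The squared modulus, as a real number. *)
Definition sqnorm (z : K) : R := re_part z ^+ 2 + im_part z ^+ 2.

Lemma sqnorm_gt0 (z : K) : (0 < sqnorm z) = (z != 0).
Proof.
rewrite lt0r addr_ge0 ?sqr_ge0// andbT; congr negb.
rewrite paddr_eq0 ?sqr_ge0// !sqrf_eq0.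
by case: (k) z => /= [z|[a b]]; [rewrite eqxx andbT | rewrite eq_complex].
Qed.

Lemma smooth_fun_local U f :
  (forall x, U x -> exists2 W, W x & smooth_fun W f) -> smooth_fun U f.
Proof.
by move=> H; split; apply: smooth_real_local => x /H[W Wx [? ?]]; exists W.
Qed.

Lemma smooth_fun_ext U f g : open U -> (forall x, U x -> f x = g x) ->
  smooth_fun U f -> smooth_fun U g.
Proof.
move=> oU fg [rf jf].
by split; [move: rf|move: jf]; apply: smooth_real_ext => // x /fg /= ->.
Qed.

Lemma smooth_funN U f : open U -> smooth_fun U f -> smooth_fun U (fun x => - f x).
Proof.
move=> oU sf; apply: smooth_fun_ext (smooth_funM oU (smooth_fun_cst U (-1)) sf) => //.
by move=> x _; rewrite mulN1r.
Qed.

Lemma smooth_fun_sum U (I : Type) (r : seq I) (F : I -> M -> K) : open U ->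
  (forall i, smooth_fun U (F i)) -> smooth_fun U (fun x => \sum_(i <- r) F i x).
Proof.
move=> oU sF; elim: r => [|i r IH].
  by apply: smooth_fun_ext (smooth_fun_cst U 0) => // x _; rewrite big_nil.
apply: smooth_fun_ext (smooth_funD oU (sF i) IH) => // x _.
by rewrite big_cons.
Qed.

Lemma smooth_fun_prod U (I : Type) (r : seq I) (F : I -> M -> K) : open U ->
  (forall i, smooth_fun U (F i)) -> smooth_fun U (fun x => \prod_(i <- r) F i x).
Proof.
move=> oU sF; elim: r => [|i r IH].
  by apply: smooth_fun_ext (smooth_fun_cst U 1) => // x _; rewrite big_nil.
apply: smooth_fun_ext (smooth_funM oU (sF i) IH) => // x _.
by rewrite big_cons.
Qed.

Lemma smooth_sqnorm U f : open U -> smooth_fun U f ->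
  smooth_real U (fun x => sqnorm (f x)).
Proof. by move=> oU [rf jf]; apply: smooth_realD => //; exact: smooth_realM. Qed.

(** 1/z has real part Re z / |z|^2 and imaginary part - Im z / |z|^2. *)
Lemma smooth_funV U f : open U -> (forall x, U x -> f x != 0) ->
  smooth_fun U f -> smooth_fun U (fun x => (f x)^-1).
Proof.
move=> oU f0 sf; have [rf jf] := sf.
have sV : smooth_real U (fun x => (sqnorm (f x))^-1).
  apply: smooth_realV => //; last exact: smooth_sqnorm.
  by move=> x /f0; rewrite -sqnorm_gt0 => /lt0r_neq0.
split.
  apply: smooth_real_ext (smooth_realM oU rf sV) => // x /f0 /=; rewrite /sqnorm.
  case: (k) f {f0 sf rf jf sV} => /= f; last by case: (f x).
  by move=> fx0; rewrite expr0n addr0 expr2 invfM mulrA divff ?mul1r.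
apply: smooth_real_ext (smooth_realN oU (smooth_realM oU jf sV)) => // x /f0 /=.
rewrite /sqnorm; case: (k) f {f0 sf rf jf sV} => /= f; last by case: (f x).
by rewrite mul0r oppr0.
Qed.

Lemma smooth_fun_neq0 U f x : open U -> U x -> smooth_fun U f -> f x != 0 ->
  \forall y \near x, f y != 0.
Proof.
move=> oU Ux sf; rewrite -sqnorm_gt0 => f0.
have /(_ [set t | 0 < t]) := smooth_real_continuous oU Ux (smooth_sqnorm oU sf).
have N0 : nbhs (sqnorm (f x)) [set t | 0 < t].
  by apply: open_nbhs_nbhs; split => //; exact: open_gt.
move=> /(_ N0) H; have : \forall y \near x, 0 < sqnorm (f y) by exact: H.
by apply: filterS => y; rewrite sqnorm_gt0.
Qed.

Lemma smooth_fun_det U n (A : M -> 'M[K]_n) : open U ->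
  (forall i j, smooth_fun U (fun x => A x i j)) -> smooth_fun U (fun x => \det (A x)).
Proof.
move=> oU sA; apply: smooth_fun_sum => // s.
apply: smooth_funM => //; first exact: smooth_fun_cst.
exact: smooth_fun_prod.
Qed.

(** Cramer's rule. *)
Lemma smooth_fun_invmx U n (A : M -> 'M[K]_n) : open U ->
  (forall x, U x -> A x \in unitmx) ->
  (forall i j, smooth_fun U (fun x => A x i j)) ->
  forall i j, smooth_fun U (fun x => invmx (A x) i j).
Proof.
move=> oU uA sA i j.
have sD : smooth_fun U (fun x => (\det (A x))^-1).
  apply: smooth_funV => //; last exact: smooth_fun_det.
  by move=> x /uA; rewrite unitmxE unitfE.
have sC : smooth_fun U (fun x => cofactor (A x) j i).
  apply: smooth_funM => //; first exact: smooth_fun_cst.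
  apply: smooth_fun_det => // a b.
  by apply: smooth_fun_ext (sA (lift j a) (lift i b)) => // x _; rewrite !mxE.
apply: smooth_fun_ext (smooth_funM oU sD sC) => // x /uA Ax.
by rewrite /invmx Ax !mxE.
Qed.

Lemma bump_fun x U : open U -> U x -> exists f : M -> K,
  [/\ smooth_fun setT f, \forall y \near x, f y = 1
    & exists V, [/\ open V, (forall y, U y \/ V y) & forall y, V y -> f y = 0]].
Proof.
move=> oU Ux; have [g [sg g1 [V [oV UV g0]]]] := bump_real oU Ux.
have E (z : R) : (re_part (scal_of_real z) = z) * (im_part (scal_of_real z) = 0).
  by rewrite /scal_of_real; case: (k).
have E1 : scal_of_real 1 = 1 by rewrite /scal_of_real; case: (k).
have E0 : scal_of_real 0 = 0 by rewrite /scal_of_real; case: (k).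
exists (scal_of_real \o g); split.
- split; first by apply: smooth_real_ext sg => [|y _ /=]; [exact: openT | rewrite E].
  apply: smooth_real_ext (smooth_real_cst _ 0) => [|y _ /=]; first exact: openT.
  by rewrite E.
- by apply: filterS g1 => y /= ->; rewrite E1.
- by exists V; split=> // y /g0 /= ->; rewrite E0.
Qed.

End SmoothFun.

(** * Families of vector spaces, frames and tensorial operators *)

Section Families.
Variables (R : realType) (k : scalars) (M : manifold R).
Local Notation K := (scal R k).
Local Notation family := (family k M).
Local Notation Cinf := (Cinf k M).
Local Notation triv := (triv k M).
Implicit Types (F G : family) (U V W : set M).

Lemma lin_ext (K0 : fieldType) (V0 W0 : lmodType K0) (f g : lin V0 W0) :
  (forall v, f v = g v) -> f = g.
Proof. by move=> fg; apply/val_inj/funext. Qed.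

Lemma Gamma_ext F (s t : Gamma F) : (forall x, s x = t x) -> s = t.
Proof. by move=> st; apply/val_inj/functional_extensionality_dep. Qed.

Lemma GammaD F (s t : Gamma F) x : (s + t) x = s x + t x. Proof. by []. Qed.
Lemma GammaZ F c (s : Gamma F) x : (c *: s) x = c *: s x. Proof. by []. Qed.
Lemma GammaN F (s : Gamma F) x : (- s) x = - s x. Proof. by []. Qed.

Lemma Gamma_sum F (I : Type) (r : seq I) (s : I -> Gamma F) x :
  (\sum_(i <- r) s i) x = \sum_(i <- r) s i x.
Proof. by apply: (big_morph (fun s : Gamma F => s x)). Qed.

(** Sections over U are total functions of which only the values on U matter,
so gluing is expressed through local agreement with sections; this includes the
invariance of secs U under changes outside U. *)
Definition is_sheaf F := forall U (s : psec F), open U ->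
  (forall x, U x -> exists W (t : psec F),
     [/\ open W, W x, secs W t & forall y, W y -> s y = t y]) -> secs U s.

Lemma secs_sum F U (I : Type) (r : seq I) (s : I -> psec F) : open U ->
  (forall i, secs U (s i)) -> secs U (\sum_(i <- r) s i).
Proof.
move=> oU ss; elim: r => [|i r IH]; first by rewrite big_nil; exact: secs0.
by rewrite big_cons; exact: secsD.
Qed.

Lemma psec_sum F (I : Type) (r : seq I) (s : I -> psec F) x :
  (\sum_(i <- r) s i) x = \sum_(i <- r) s i x.
Proof. by apply: (big_morph (fun s : psec F => s x)). Qed.

Lemma triv_sheaf : is_sheaf triv.
Proof.
move=> U s oU H; apply: smooth_fun_local => x /H[W [t [oW Wx st ts]]].
by exists W => //; apply: smooth_fun_ext st => // y /ts.
Qed.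

Lemma Hom_sheaf F G : is_sheaf G -> is_sheaf (Hom F G).
Proof.
move=> shG U h oU H V s oV VU ss; apply: shG => // x Vx.
have [W [t [oW Wx st ts]]] := H x (VU x Vx).
exists (V `&` W), (fun x => t x (s x)); split => //; first exact: openI.
  apply: st; [exact: openI | by move=> ? [] | ].
  by apply: secsW ss; [exact: openI | move=> ? []].
by move=> y [_ /ts ->].
Qed.

Section FrameCoordinates.
Variables (F : family) (e : frame F).
Local Notation r := (frame_rank e).

(** The coordinates in a basis are linear because they are unique. *)
Lemma frame_coord_lin x : frame_dom e x -> exists c : lin (F x) 'rV[K]_r,
  (forall v, v = \sum_i c v ord0 i *: frame_vec i x) /\
  (forall v (d : 'rV[K]_r), v = \sum_i d ord0 i *: frame_vec i x -> c v = d).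
Proof.
move=> ex; have B := frame_basis ex.
pose c v := sval (cid (B v)).
have cP v : v = \sum_i c v ord0 i *: frame_vec i x.
  by rewrite /c; case: cid => ? [].
have cU v (d : 'rV[K]_r) : v = \sum_i d ord0 i *: frame_vec i x -> c v = d.
  by rewrite /c; case: cid => ? [? H] /=; exact: H.
have cl : linear c.
  move=> a u v; apply: cU; rewrite {1}(cP u) {1}(cP v) scaler_sumr -big_split.
  by apply: eq_bigr => i _ /=; rewrite scalerA -scalerDl !mxE.
by exists (Lin (asboolT cl)).
Qed.

End FrameCoordinates.

(** A local frame together with its dual frame.  Keeping the coordinates as
smooth sections of F^* makes the smoothness of the coordinates of any section
part of the structure. *)
Definition dual_frame F W (I : finType) (e : I -> psec F)
    (c : I -> psec (dual F)) :=
  [/\ forall i, secs W (e i), forall i, secs W (c i),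
      forall x, W x -> forall v : F x, v = \sum_i (c i x v : K) *: e i x
    & forall x, W x -> forall i j, c i x (e j x) = (i == j)%:R :> K].

Lemma dual_frame_of_locally_trivial F x : locally_trivial F ->
  exists W n (e : 'I_n -> psec F) (c : 'I_n -> psec (dual F)),
    [/\ open W, W x & dual_frame W e c].
Proof.
move=> [B [cover secsP]]; have [e Be ex] := cover x.
pose W := frame_dom e; pose n := frame_rank e.
pose C y (Wy : W y) := sval (cid (frame_coord_lin Wy)).
have CP y (Wy : W y) v : v = \sum_i C y Wy v ord0 i *: frame_vec i y.
  by rewrite /C; case: cid => ? [].
have CU y (Wy : W y) v (d : 'rV[K]_n) :
    v = \sum_i d ord0 i *: frame_vec i y -> C y Wy v = d.
  by rewrite /C; case: cid => ? [? H] /=; exact: H.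
have cl i y (Wy : W y) : linear (fun v => C y Wy v ord0 i : K^o).
  by move=> a u v; rewrite linearP !mxE.
pose c i : psec (dual F) := fun y =>
  if pselect (W y) is left Wy then Lin (asboolT (cl i y Wy)) else 0.
have cE i y v (Wy : W y) : c i y v = C y Wy v ord0 i.
  by rewrite /c; case: pselect => // Wy'; rewrite (Prop_irrelevance Wy' Wy).
exists W, n, (frame_vec (f:=e)), c; split => //; first exact: frame_open.
split.
- exact: frame_smooth.
- move=> i V s oV VW ss.
  have [d [sd dE]] := (secsP V s oV).1 ss e Be.
  apply: smooth_fun_ext (_ : smooth_fun V (d i)) => //.
    move=> y Vy; have Wy := VW y Vy; rewrite (cE i y _ Wy).
    rewrite (CU y Wy _ (\row_j d j y)) ?mxE//.
    by rewrite dE //; apply: eq_bigr => j _; rewrite mxE.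
  by apply: smooth_funW (sd i) => y Vy; split => //; exact: VW.
- move=> y Wy v; rewrite {1}(CP y Wy v); apply: eq_bigr => i _.
  by rewrite (cE i y v Wy).
- move=> y Wy i j; rewrite (cE i y _ Wy) (CU y Wy _ (\row_l (l == j)%:R)).
    by rewrite mxE.
  rewrite (bigD1 j)//= mxE eqxx scale1r big1 ?addr0// => l lj.
  by rewrite mxE (negbTE lj) scale0r.
Qed.

(** The coordinates in a frame are unique, so smooth coordinates of local
sections agree with the pointwise coordinates of the function being glued. *)
Lemma locally_trivial_sheaf F : locally_trivial F -> is_sheaf F.
Proof.
move=> [B [cover secsP]] U s oU H; apply/(secsP _ _ oU) => e Be.
have E (x : M) : exists c : 'rV[K]_(frame_rank e),
    frame_dom e x -> s x = \sum_i c ord0 i *: frame_vec i x.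
  have [ex|nex] := pselect (frame_dom e x); last by exists 0.
  by have [c [cE _]] := frame_basis ex (s x); exists c.
pose c x := sval (cid (E x)).
have cP x : frame_dom e x -> s x = \sum_i c x ord0 i *: frame_vec i x.
  by rewrite /c; case: cid.
exists (fun i x => c x ord0 i); split; last by move=> x [_ /cP].
move=> i; apply: smooth_fun_local => x [Ux ex].
have [W [t [oW Wx st ts]]] := H x Ux.
have [d [sd dE]] := (secsP W t oW).1 st e Be.
exists (W `&` frame_dom e) => //; apply: smooth_fun_ext (sd i).
  by apply: openI => //; exact: frame_open.
move=> y [Wy ey]; have [b [bE bU]] := frame_basis ey (s y).
have -> : c y = b by apply/esym/bU; exact: cP.
have -> : b = \row_j d j y.
  apply: bU; rewrite ts// dE//; apply: eq_bigr => j _; by rewrite mxE.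
by rewrite mxE.
Qed.

(** Sections have smooth coordinates because the c_i are smooth; conversely a
function with smooth coordinates is locally a combination of the sections e_i,
and sections glue.  The index type is any finType so that frames may be indexed
by pairs and by sums. *)
Lemma locally_trivial_of_dual_frames F : is_sheaf F ->
  (forall x, exists W (I : finType) (e : I -> psec F) (c : I -> psec (dual F)),
    [/\ open W, W x & dual_frame W e c]) -> locally_trivial F.
Proof.
move=> shF H.
exists [set e : frame F | exists c, dual_frame (frame_dom e) (frame_vec (f:=e)) c].
have cover x : exists2 e : frame F,
    (exists c, dual_frame (frame_dom e) (frame_vec (f:=e)) c) & frame_dom e x.
  have [W [I [e [c [oW Wx [se sc ce cd]]]]]] := H x.
  have ce' y (Wy : W y) v :
      v = \sum_(i < #|I|) (c (enum_val i) y v : K) *: e (enum_val i) y.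
    by rewrite {1}(ce y Wy v) [LHS](reindex _ (onW_bij _ (enum_val_bij I))).
  have cd' y (Wy : W y) (i j : 'I_#|I|) :
      c (enum_val i) y (e (enum_val j) y) = (i == j)%:R :> K.
    by rewrite cd// (inj_eq enum_val_inj).
  have eb y (Wy : W y) (v : F y) :
     exists! a : 'rV[K]_#|I|, v = \sum_i a ord0 i *: e (enum_val i) y.
    exists (\row_i c (enum_val i) y v); split=> [|a ->].
      by rewrite {1}(ce' y Wy v); apply: eq_bigr => i _; rewrite mxE.
    apply/rowP => i; rewrite mxE linear_sum (bigD1 i)//= linearZ /= cd' // eqxx.
    rewrite big1 => [|j ji]; first by rewrite addr0 [LHS]mulr1.
    by rewrite linearZ /= cd'// eq_sym (negbTE ji) [LHS]mulr0.
  exists (@Frame _ _ _ F W #|I| (fun i => e (enum_val i)) oW (fun i => se _) eb) => //=.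
  by exists (fun i => c (enum_val i)); split.
split=> [//|U s oU]; split=> [ss e [c [_ sc ce _]]|ss].
  exists (fun i y => c i y (s y)); split=> [i|y [_ ey]]; last exact: ce.
  have oUe : open (U `&` frame_dom e) by apply: openI => //; exact: frame_open.
  apply: (sc i); [exact: oUe| by move=> ? []|].
  by apply: secsW ss => // ? [].
apply: shF => // x Ux; have [e Be ex] := cover x.
have [c [sc cE]] := ss e Be.
have oUe : open (U `&` frame_dom e) by apply: openI => //; exact: frame_open.
exists (U `&` frame_dom e), (\sum_i ((fun y => c i y *: frame_vec i y) : psec F)).
split => //; last by move=> y /cE ->; rewrite psec_sum.
apply: secs_sum => // i; apply: secsZ => //.
by apply: secsW (frame_smooth i) => // ? [].
Qed.

(** As chi vanishes off a closed subset of M contained in U, the product of chi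
with a section over U glues with the zero section. *)
Lemma cutoff x U : open U -> U x -> exists chi : Cinf,
  [/\ \forall y \near x, chi y = 1, forall y, ~ U y -> chi y = 0
    & forall F (s : psec F), is_sheaf F -> secs U s ->
        secs [set: M] (fun y => chi y *: s y)].
Proof.
move=> oU Ux; have [f [sf f1 [V [oV UV f0]]]] := bump_fun k oU Ux.
exists (@mk_sec _ _ _ triv f sf); split=> // [y nU|F s shF ss].
  by apply: f0; case: (UV y).
apply: shF => [|y _]; first exact: openT.
have [Uy|Vy] := UV y.
  exists U, (fun y => f y *: s y); split => //; apply: secsZ => //.
  exact: smooth_funW sf.
exists V, 0; split => //; first exact: secs0.
by move=> z Vz; rewrite /= f0// scale0r.
Qed.

Lemma near_open x (P : M -> Prop) : (\forall y \near x, P y) ->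
  exists W, [/\ open W, W x & forall y, W y -> P y].
Proof.
move=> nP; have : nbhs x P by [].
by rewrite nbhsE => -[W [oW Wx] WP]; exists W.
Qed.

Lemma section_extension F x U (s : psec F) : is_sheaf F ->
  open U -> U x -> secs U s -> exists t : Gamma F, exists W,
    [/\ open W, W x & forall y, W y -> t y = s y].
Proof.
move=> shF oU Ux ss; have [chi [/near_open[W [oW Wx W1]] _ chiP]] := cutoff oU Ux.
exists (mk_sec (chiP _ _ shF ss)), W; split => // y /W1 /= ->.
by rewrite scale1r.
Qed.

(** The sections e_i and c_i are those of a local dual frame, each multiplied
by the same cutoff chi, and phi = chi^2.  The expansion holds on all of M, so it
can be put under an operator acting on global sections. *)
Lemma global_dual_frame F x : locally_trivial F ->
  exists n (e : 'I_n -> Gamma F) (c : 'I_n -> Gamma (dual F)) (phi : Cinf) W,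
  [/\ [/\ open W, W x & forall y, W y -> phi y = 1],
      forall y (v : F y), phi y *: v = \sum_i (c i y v : K) *: e i y
    & forall y, W y -> forall i j, c i y (e j y) = (i == j)%:R :> K].
Proof.
move=> ltF; have shF := locally_trivial_sheaf ltF.
have [U [n [e [c [oU Ux [se sc ce cd]]]]]] := dual_frame_of_locally_trivial x ltF.
have [chi [/near_open[W [oW Wx W1]] chi0 chiP]] := cutoff oU Ux.
exists n, (fun i => mk_sec (chiP _ _ shF (se i))).
exists (fun i => mk_sec (chiP _ _ (Hom_sheaf triv_sheaf) (sc i))).
exists (fscale chi chi), (U `&` W); split.
- split=> [||y [_ /W1 c1]]; [exact: openI|by []|].
  by rewrite /= c1 [LHS]mulr1.
- move=> y v /=.
  have [Uy|nU] := pselect (U y); last first.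
    by rewrite !chi0// !scale0r big1// => i _; rewrite !scale0r.
  rewrite {1}(ce y Uy v) scaler_sumr; apply: eq_bigr => i _.
  by rewrite !scalerA -[in RHS](mulrC (chi y)) mulrA.
- move=> y [Uy /W1 c1] i j /=; rewrite c1 !scale1r.
  exact: cd.
Qed.

Lemma section_through F x (v : F x) : locally_trivial F ->
  exists s : Gamma F, s x = v.
Proof.
move=> ltF; have [n [e [c [phi [W [[_ Wx W1] ce _]]]]]] := global_dual_frame x ltF.
exists (\sum_i (c i x v : K) *: e i).
by rewrite Gamma_sum -[RHS]scale1r -(W1 x Wx) ce.
Qed.

Lemma Hom_ext F G (h h' : Gamma (Hom F G)) : locally_trivial F ->
  (forall s, happly h s = happly h' s) -> h = h'.
Proof.
move=> ltF hh; apply: Gamma_ext => x; apply: lin_ext => v.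
have [s <-] := section_through v ltF.
by have := congr1 (fun t : Gamma G => t x) (hh s).
Qed.

Lemma fscaleE F (f : Cinf) (s : Gamma F) x : fscale f s x = f x *: s x.
Proof. by []. Qed.

Lemma happlyE F G (h : Gamma (Hom F G)) s x : happly h s x = h x (s x).
Proof. by []. Qed.

(** With e_i, c_i and phi as in global_dual_frame, phi s is the sum of the
<c_i, s> e_i, hence T(s)(x) is the sum of the c_i(s(x)) T(e_i)(x). *)
Lemma tensorial_pointwise F G (T : Gamma F -> Gamma G) x : locally_trivial F ->
  linear T -> (forall f s, T (fscale f s) = fscale f (T s)) ->
  exists h : lin (F x) (G x), forall s, T s x = h (s x).
Proof.
move=> ltF linT TZ.
have [n [e [c [phi [W [[_ Wx W1] ce _]]]]]] := global_dual_frame x ltF.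
have hl : linear (fun v : F x => \sum_i (c i x v : K) *: T (e i) x).
  move=> a u v; rewrite scaler_sumr -big_split; apply: eq_bigr => i _ /=.
  by rewrite linearP /= scalerDl scalerA.
exists (Lin (asboolT hl)) => s /=.
have T0 : T 0 = 0.
  by have := linT (-1) 0 0; rewrite scaler0 addr0 scaleN1r addNr.
have TD : {morph T : u v / u + v}.
  by move=> u v; have := linT 1 u v; rewrite !scale1r.
have sE : fscale phi s = \sum_i fscale (happly (c i) s) (e i).
  apply: Gamma_ext => y; rewrite Gamma_sum /= ce.
  by apply: eq_bigr.
have := congr1 (fun t : Gamma G => t x) (TZ phi s).
rewrite /= sE (W1 x Wx) scale1r (big_morph T TD T0) Gamma_sum => <-.
by apply: eq_bigr => i _; rewrite TZ.
Qed.

(** The linear maps of tensorial_pointwise vary smoothly because a local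
section agrees near each point with a global one, to which T applies. *)
Lemma tensorial_Hom F G (T : Gamma F -> Gamma G) :
  locally_trivial F -> is_sheaf G ->
  linear T -> (forall f s, T (fscale f s) = fscale f (T s)) ->
  exists h : Gamma (Hom F G), forall s, happly h s = T s.
Proof.
move=> ltF shG linT TZ.
pose h x := sval (cid (tensorial_pointwise x ltF linT TZ)).
have hP s x : T s x = h x (s x) by rewrite /h; case: cid.
have sh : @secs _ _ _ (Hom F G) [set: M] h.
  move=> V s oV _ ss; apply: shG => // x Vx.
  have [t [W [oW Wx tW]]] := section_extension (locally_trivial_sheaf ltF) oV Vx ss.
  exists W, (T t); split => //; first by apply: secsW (GammaP _) => //; exact: openT.
  by move=> y /tW st; rewrite -st hP.
by exists (mk_sec sh) => s; apply: Gamma_ext => x; rewrite hP.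
Qed.

End Families.

(** * Frames of L adapted to A *)

(** The rows of C are a basis of a complement of the row space of B. *)
Lemma row_free_completion (K : fieldType) p q (B : 'M[K]_(p, p + q)) :
  row_free B -> exists C : 'M[K]_(q, p + q), col_mx B C \in unitmx.
Proof.
move=> fB; have rB : \rank B^C%MS = q by rewrite mxrank_compl (eqP fB) addKn.
have [C CB] : exists C : 'M[K]_(q, p + q), (C :=: B^C)%MS.
  have base n (D : 'M[K]_n) r : \rank D = r -> exists C : 'M_(r, n), (C :=: D)%MS.
    by move=> <-; exists (row_base D); exact: eq_row_base.
  exact: base.
exists C; rewrite -row_full_unit -sub1mx -addsmxE.
have /andP[_ H] : (B + C == B + B^C)%MS by apply/eqmxP; exact: adds_eqmx.
by apply: submx_trans H; rewrite sub1mx addsmx_compl_full.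
Qed.

Section Frames.
Variables (R : realType) (k : scalars) (M : manifold R).
Local Notation K := (scal R k).
Local Notation family := (family k M).
Local Notation Cinf := (Cinf k M).
Local Notation triv := (triv k M).
Implicit Types (F G : family) (U V W : set M).

Lemma dual_frameW F U W (I : finType) (e : I -> psec F) (c : I -> psec (dual F)) :
  open U -> U `<=` W -> dual_frame W e c -> dual_frame U e c.
Proof.
move=> oU UW [se sc ce cd]; split=> [i|i|y /UW|y /UW]; [| |exact: ce|exact: cd].
  exact: secsW (se i).
exact: secsW (sc i).
Qed.

(** The dual frame changes by the inverse matrix, which is smooth by Cramer's
rule. *)
Lemma change_of_frame F W n (e : 'I_n -> psec F) (c : 'I_n -> psec (dual F))
    (N : M -> 'M[K]_n) : open W -> dual_frame W e c ->
  (forall i j, smooth_fun W (fun x => N x i j)) ->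
  (forall x, W x -> N x \in unitmx) ->
  dual_frame W (fun i => (fun x => \sum_j N x i j *: e j x) : psec F)
    (fun i => (fun x => \sum_j invmx (N x) j i *: c j x) : psec (dual F)).
Proof.
move=> oW [se sc ce cd] sN uN.
have sNV := smooth_fun_invmx oW uN sN.
have lincomb G (d : 'I_n -> psec G) (f : M -> 'I_n -> K) :
    (forall j, secs W (d j)) -> (forall j, smooth_fun W (f^~ j)) ->
    secs W ((fun x => \sum_j f x j *: d j x) : psec G).
  move=> sd sf.
  have -> : ((fun x => \sum_j f x j *: d j x) : psec G) =
      \sum_j ((fun x => f x j *: d j x) : psec G).
    by apply: functional_extensionality_dep => x; rewrite psec_sum.
  by apply: secs_sum => // j; exact: secsZ.
have dE x i v : (\sum_j invmx (N x) j i *: c j x) v =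
    \sum_j invmx (N x) j i * (c j x v : K) :> K.
  by apply: (big_morph (fun h : dual F x => h v : K)).
split=> [i|i|x Wx v|x Wx i j].
- exact: lincomb.
- exact: (lincomb (dual F)).
- rewrite {1}(ce x Wx v).
  under [RHS]eq_bigr => i _ do rewrite dE scaler_sumr.
  rewrite exchange_big; apply: eq_bigr => j _ /=.
  under eq_bigr => i _ do rewrite scalerA.
  rewrite -scaler_suml; congr (_ *: _).
  under eq_bigr => i _ do rewrite mulr_suml.
  rewrite exchange_big /=.
  transitivity (\sum_l (c l x v : K) * (invmx (N x) *m N x) l j).
    rewrite mulVmx ?uN// (bigD1 j)//= mxE eqxx mulr1 big1 ?addr0// => l lj.
    by rewrite mxE (negbTE lj) mulr0.
  apply: eq_bigr => l _; rewrite mxE mulr_sumr; apply: eq_bigr => i _.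
  by rewrite [_ * (c l x v : K)]mulrC mulrA.
- rewrite dE.
  transitivity ((N x *m invmx (N x)) j i); last first.
    by rewrite mulmxV ?uN// mxE eq_sym.
  rewrite mxE; apply: eq_bigr => l _.
  rewrite linear_sum (bigD1 l)//= linearZ /= cd// eqxx big1 ?addr0 => [|m ml].
    by rewrite mulrC; congr (_ * _); exact: mulr1.
  by rewrite linearZ /= cd// eq_sym (negbTE ml) [LHS]mulr0.
Qed.

Lemma dual_frame_coord F W (I : finType) (e : I -> psec F) (c : I -> psec (dual F))
    x (d : I -> K) i : dual_frame W e c -> W x ->
  c i x (\sum_j d j *: e j x) = d i.
Proof.
move=> [_ _ _ cd] Wx; rewrite linear_sum (bigD1 i)//= linearZ /= cd// eqxx.
rewrite big1 => [|j ji]; first by rewrite addr0 [LHS]mulr1.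
by rewrite linearZ /= cd// eq_sym (negbTE ji) [LHS]mulr0.
Qed.

End Frames.

Section Pair.
Variables (R : realType) (k : scalars) (M : manifold R) (P : lie_pair k M).
Local Notation K := (scal R k).
Local Notation L := (lp_L P).
Local Notation A := (lp_A P).
Local Notation inc := (lp_inc P).
Local Notation family := (family k M).
Local Notation Cinf := (Cinf k M).
Local Notation triv := (triv k M).

Lemma HomQ_sheaf (F : family) : is_sheaf F -> is_sheaf (HomQ P F).
Proof.
move=> shF U h oU H; apply: (Hom_sheaf (F := L) shF) => // x Ux.
have [W [t [oW Wx st ts]]] := H x Ux.
exists W, ((fun y => ahom_lin (t y)) : psec (Hom L F)); split => //.
by move=> y /ts ->.
Qed.

Lemma ahom0 (F : family) y (h : HomQ P F y) (b : A y) : h (inc y b) = 0.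
Proof. exact: (asboolW (ahom_subproof h)). Qed.

Lemma HomQ_of_Hom (F : family) (h : Gamma (Hom L F)) :
  (forall y (b : A y), h y (inc y b) = 0) ->
  exists h' : Gamma (HomQ P F), forall y v, h' y v = h y v.
Proof.
move=> h0.
pose g : psec (HomQ P F) := fun y => AHom (asboolT (h0 y)).
have sg : secs [set: M] g by exact: (GammaP h).
by exists (mk_sec sg).
Qed.

Lemma HomQ_ext (F : family) (h h' : Gamma (HomQ P F)) :
  (forall (l : Gamma L) x, h x (l x) = h' x (l x)) -> h = h'.
Proof.
move=> hh; apply: Gamma_ext => x; apply: val_inj; apply: lin_ext => v /=.
by have [l <-] := section_through v (la_loc L).
Qed.

(** The rows of B are the coordinates of a frame of A in a frame of L.  At x
they are independent, the inclusion being injective; constant rows C complete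
them to an invertible matrix at x, hence near x, and changing the frame of L by
this matrix makes the frame of A its initial part. *)
Lemma adapted_local_frame x : exists W p q (a : 'I_p -> psec A)
    (l : 'I_(p + q) -> psec L) (lam : 'I_(p + q) -> psec (dual L)),
  [/\ open W, W x, dual_frame W l lam, forall i, secs W (a i)
    & forall y, W y -> (forall i, l (lshift q i) y = inc y (a i y)) /\
      (forall b : A y, b = \sum_i (lam (lshift q i) y (inc y b) : K) *: a i y)
      /\ forall j (b : A y), lam (rshift p j) y (inc y b) = 0].
Proof.
have [U [p [a [alp [oU Ux fa]]]]] := dual_frame_of_locally_trivial x (la_loc A).
have [V [n [l [lam [oV Vx fl]]]]] := dual_frame_of_locally_trivial x (la_loc L).
have [sa _ ea da] := fa; have [sl slam el dl] := fl.
pose B y : 'M[K]_(p, n) := \matrix_(i, j) (lam j y (inc y (a i y)) : K).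
have fB : row_free (B x).
  apply/inj_row_free => v vB.
  have : inc x (\sum_i v 0 i *: a i x) = inc x 0.
    rewrite linear0 (el x Vx (inc x _)) big1// => j _.
    have -> : (lam j x (inc x (\sum_i v 0 i *: a i x)) : K) = (v *m B x) 0 j.
      rewrite !linear_sum mxE; apply: eq_bigr => i _.
      by rewrite !linearZ mxE.
    by rewrite vB mxE scale0r.
  move/(@lp_inc_inj _ _ _ P) => H; apply/rowP => i.
  by have := dual_frame_coord (v 0) i fa Ux; rewrite H linear0 mxE => <-.
(* With n of the form p + q the blocks B and C stack into a square matrix. *)
have [q nE] : exists q, n = (p + q)%N.
  exists (n - p)%N; rewrite subnKC//.
  by rewrite -(eqP fB) rank_leq_col.
subst n.
have [C BC] := row_free_completion fB.
pose N y := col_mx (B y) C.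
have oUV : open (U `&` V) by exact: openI.
have sN i j : smooth_fun (U `&` V) (fun y => N y i j).
  rewrite /N; case: (splitP i) => i' ii.
    have -> : i = lshift q i' by exact: val_inj.
    have sinc : secs (U `&` V) (fun y => inc y (a i' y)).
      apply: bm_smooth => //; by apply: secsW (sa i') => // ? [].
    have := slam j _ _ oUV (@subIsetr _ U V) sinc.
    by apply: smooth_fun_ext => // y _; rewrite col_mxEu mxE.
  have -> : i = rshift p i' by exact: val_inj.
  by apply: smooth_fun_ext (smooth_fun_cst _ (C i' j)) => // y _; rewrite col_mxEd.
have := smooth_fun_neq0 oUV (conj Ux Vx) (smooth_fun_det oUV sN).
rewrite -unitfE -unitmxE => /(_ BC)/near_open[D [oD Dx uN]].
pose W := U `&` V `&` D.
have oW : open W by exact: openI.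
have fl' : dual_frame W l lam by apply: dual_frameW fl => // ? [[]].
have sN' i j : smooth_fun W (fun y => N y i j) by apply: smooth_funW (sN i j) => ? [].
have uN' y : W y -> N y \in unitmx by rewrite unitmxE unitfE => -[_ /uN].
have f := change_of_frame oW fl' sN' uN'.
exists W, p, q, a; do 2 eexists; split; [exact: oW|by []|exact: f| |].
  by move=> i; apply: secsW (sa i) => // ? [[]].
move=> y Wy; have [[Uy Vy] _] := Wy.
have lE i : \sum_j N y (lshift q i) j *: l j y = inc y (a i y).
  rewrite [RHS](el y Vy); apply: eq_bigr => j _.
  by rewrite col_mxEu mxE.
have incE (b : A y) :
    inc y b = \sum_(i < p + q)
      (if fintype.split i is inl i' then (alp i' y b : K) else 0) *:
        (\sum_j N y i j *: l j y).
  rewrite big_split_ord /= [X in _ + X]big1 ?addr0 => [|i _]; last first.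
    by rewrite (unsplitK (inr i)) scale0r.
  rewrite {1}(ea y Uy b) linear_sum; apply: eq_bigr => i _.
  by rewrite (unsplitK (inl i)) linearZ /= lE.
have cE (b : A y) i : (\sum_j invmx (N y) j i *: lam j y) (inc y b) =
    (if fintype.split i is inl i' then (alp i' y b : K) else 0) :> K.
  by rewrite (incE b); exact: (dual_frame_coord _ i f Wy).
split; first by [].
split=> [b|j b]; last by rewrite cE (unsplitK (inr j)).
rewrite {1}(ea y Uy b); apply: eq_bigr => i _; congr (_ *: _).
by rewrite cE (unsplitK (inl i)).
Qed.

(** The frame of adapted_local_frame after multiplication by a cutoff, so that
all of it is global.  The forms alp retract L onto A up to the factor phi; the
forms lam are a frame of the annihilator of A near x, dual to l. *)
Lemma adapted_frame x : exists p q (a : 'I_p -> Gamma A)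
    (alp : 'I_p -> Gamma (dual L)) (l : 'I_q -> Gamma L)
    (lam : 'I_q -> Gamma (annihilator P)) (phi : Cinf) W,
  [/\ [/\ open W, W x & forall y, W y -> phi y = 1],
      forall y (b : A y), phi y *: b = \sum_i (alp i y (inc y b) : K) *: a i y,
      forall y, W y -> forall v : L y, exists b : A y,
        v = inc y b + \sum_j (lam j y v : K) *: l j y
    & forall y, W y -> forall i j, lam i y (l j y) = (i == j)%:R :> K].
Proof.
have [U [p [q [a [l [lam [oU Ux [sl slam el dl] sa H]]]]]]] := adapted_local_frame x.
have [chi [/near_open[W [oW Wx W1]] chi0 chiP]] := cutoff k oU Ux.
have shL := locally_trivial_sheaf (la_loc L).
have shA := locally_trivial_sheaf (la_loc A).
have shD := Hom_sheaf (F := L) (@triv_sheaf R k M).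
pose lam' j : Gamma (dual L) := mk_sec (chiP _ _ shD (slam (rshift p j))).
have lam0 j y (b : A y) : lam' j y (inc y b) = 0.
  rewrite /= -[LHS]/(chi y * lam (rshift p j) y (inc y b)).
  have [Uy|nU] := pselect (U y); last by rewrite chi0// mul0r.
  by rewrite (H y Uy).2.2 mulr0.
pose Lam j := sval (cid (HomQ_of_Hom (lam0 j))).
have LamE j y v : Lam j y v = lam' j y v by rewrite /Lam; case: cid.
exists p, q, (fun i => mk_sec (chiP _ _ shA (sa i))).
exists (fun i => mk_sec (chiP _ _ shD (slam (lshift q i)))).
exists (fun j => mk_sec (chiP _ _ shL (sl (rshift p j)))), Lam.
exists (fscale chi chi), (U `&` W); split.
- split=> [||y [_ /W1 c1]]; [exact: openI|by []|].
  by rewrite /= c1 [LHS]mulr1.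
- move=> y b /=.
  have [Uy|nU] := pselect (U y); last first.
    by rewrite !chi0// !scale0r big1// => i _; rewrite !scale0r.
  rewrite {1}((H y Uy).2.1 b) scaler_sumr; apply: eq_bigr => i _.
  by rewrite !scalerA -[in RHS](mulrC (chi y)) mulrA.
- move=> y [Uy /W1 c1] v.
  exists (\sum_i (lam (lshift q i) y v : K) *: a i y).
  rewrite {1}(el y Uy v) big_split_ord /=; congr (_ + _).
    rewrite linear_sum; apply: eq_bigr => i _.
    by rewrite linearZ /= (H y Uy).1.
  by apply: eq_bigr => j _; rewrite LamE /= !c1 !scale1r.
- move=> y [Uy /W1 c1] i j; rewrite LamE /= c1 !scale1r dl//.
  by rewrite (inj_eq (@rshift_inj _ _)).
Qed.

End Pair.

(** * Calculus on a Lie algebroid *)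

Section LinearFunctions.
Variables (K : pzRingType) (U V : lmodType K) (T : U -> V).
Hypothesis linT : linear T.

Lemma linfunD u v : T (u + v) = T u + T v.
Proof. by have := linT 1 u v; rewrite !scale1r. Qed.

Lemma linfun0 : T 0 = 0.
Proof. by apply: (addrI (T 0)); rewrite -linfunD !addr0. Qed.

Lemma linfunZ c u : T (c *: u) = c *: T u.
Proof. by have := linT c u 0; rewrite linfun0 !addr0. Qed.

Lemma linfunN u : T (- u) = - T u.
Proof. by rewrite -scaleN1r linfunZ scaleN1r. Qed.

Lemma linfunB u v : T (u - v) = T u - T v.
Proof. by rewrite linfunD linfunN. Qed.

End LinearFunctions.

Section Calculus.
Variables (R : realType) (k : scalars) (M : manifold R).
Local Notation K := (scal R k).
Local Notation family := (family k M).
Local Notation Cinf := (Cinf k M).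
Local Notation triv := (triv k M).
Implicit Types (F G : family) (L : lie_algebroid k M) (f g : Cinf).

Lemma happly_linear F G (h : Gamma (Hom F G)) : linear (happly h).
Proof. by move=> c s t; apply: Gamma_ext => x; rewrite /= linearP. Qed.

Lemma happlyZ F G (h : Gamma (Hom F G)) f s :
  happly h (fscale f s) = fscale f (happly h s).
Proof. by apply: Gamma_ext => x; rewrite /= linearZ. Qed.

Lemma fscale_linear F f : linear (@fscale R k M F f).
Proof.
move=> c s t; apply: Gamma_ext => x.
by rewrite /= linearP.
Qed.

Lemma rhoE L (l : Gamma L) f x : rho l f x = anchor L x (l x) f.
Proof. by []. Qed.

Lemma tangentP x (v : TM k M x) : derivation_at x v.
Proof. exact: asboolW (tan_subproof v). Qed.

Lemma rho_linear L (l : Gamma L) : linear (rho l).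
Proof.
move=> c f g; apply: Gamma_ext => x.
by rewrite rhoE (tangentP _).1.
Qed.

Lemma rho_leibniz L (l : Gamma L) f g :
  rho l (fscale f g) = fscale (rho l f) g + fscale f (rho l g).
Proof.
apply: Gamma_ext => x; rewrite rhoE (tangentP _).2 addrC; congr (_ + _).
exact: mulrC.
Qed.

Lemma rho_linear_l L f : linear (fun l : Gamma L => rho l f).
Proof. by move=> c l m; apply: Gamma_ext => x; rewrite rhoE /= linearP. Qed.

Lemma rho_fscale L g (l : Gamma L) f : rho (fscale g l) f = fscale g (rho l f).
Proof. by apply: Gamma_ext => x; rewrite rhoE /= linearZ. Qed.

Lemma rho_bracket L (l m : Gamma L) f :
  rho (bracket l m) f = rho l (rho m f) - rho m (rho l f).
Proof. exact: anchor_bracket. Qed.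

(** Thus the trivial line bundle carries the action rho, and the action on the
annihilator is the case F = triv of the action on Hom(L/A, F). *)
Lemma rho_connection L : @is_connection R k M L triv (@rho R k M L).
Proof.
split; [exact: rho_linear_l|exact: rho_linear|exact: (fun f l => rho_fscale f l)|].
exact: (fun f l => rho_leibniz l f).
Qed.

Lemma bracketC L (l m : Gamma L) : bracket l m = - bracket m l.
Proof.
have D (a b c : Gamma L) : bracket (a + b) c = bracket a c + bracket b c.
  by have := bracketDl c 1 a b; rewrite !scale1r.
have D' (a b c : Gamma L) : bracket c (a + b) = bracket c a + bracket c b.
  by have := bracketDr c 1 a b; rewrite !scale1r.
have := bracket_alt (l + m); rewrite D !D' !bracket_alt add0r addr0.
by move/eqP; rewrite addr_eq0 => /eqP.
Qed.

Lemma bracket_fscaler L f (l m : Gamma L) :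
  bracket l (fscale f m) = fscale f (bracket l m) + fscale (rho l f) m.
Proof. exact: bracket_leibniz. Qed.

Lemma bracket_fscalel L f (l m : Gamma L) :
  bracket (fscale f l) m = fscale f (bracket l m) - fscale (rho m f) l.
Proof.
rewrite bracketC bracket_fscaler opprD; congr (_ - _).
by rewrite (bracketC l m) (linfunN (fscale_linear f)).
Qed.

Lemma bracketN L (l m : Gamma L) : bracket l (- m) = - bracket l m.
Proof. exact: (linfunN (bracketDr l)). Qed.

(** The Jacobi identity, with the left bracket expanded. *)
Lemma bracket_derivation L (l m n : Gamma L) :
  bracket (bracket l m) n = bracket l (bracket m n) - bracket m (bracket l n).
Proof.
have /eqP := bracket_jacobi l m n.
rewrite addr_eq0 => /eqP E.
rewrite bracketC -[LHS]/(- _) -E; congr (_ + _).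
by rewrite (bracketC l n) bracketN opprK.
Qed.

End Calculus.

(** * The dual of an action *)

Section DualAction.
Variables (R : realType) (k : scalars) (M : manifold R).
Local Notation K := (scal R k).
Local Notation Cinf := (Cinf k M).
Local Notation triv := (triv k M).
Variables (A : lie_algebroid k M) (E : lie_module A).
Implicit Types (a b : Gamma A) (eps : Gamma (dual E)) (e : Gamma E) (f : Cinf).

Lemma lm_loc : locally_trivial E. Proof. by case: (lm_module E). Qed.
Lemma lm_connection : is_connection (lm_conn (l:=E)).
Proof. by case: (lm_module E). Qed.
Lemma lm_flat : is_flat (lm_conn (l:=E)).
Proof. by case: (lm_module E). Qed.

Lemma lm_linear_l e : linear (fun a => lm_conn (l:=E) a e).
Proof. by case: lm_connection. Qed.
Lemma lm_linear a : linear (lm_conn (l:=E) a).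
Proof. by case: lm_connection. Qed.
Lemma lm_fscale f a e : lm_conn (l:=E) (fscale f a) e = fscale f (lm_conn a e).
Proof. by case: lm_connection. Qed.
Lemma lm_leibniz f a e :
  lm_conn (l:=E) a (fscale f e) = fscale (rho a f) e + fscale f (lm_conn a e).
Proof. by case: lm_connection. Qed.

(** The right-hand side is linear over the smooth functions in e: the terms
rho(a)(f) <eps, e> coming from the two Leibniz rules cancel. *)
Lemma dual_connE a eps e :
  happly (dual_conn a eps) e = rho a (happly eps e) - happly eps (lm_conn a e).
Proof.
move: e; rewrite /dual_conn; apply: (@xgetPex _ 0 [set eta : Gamma (dual E) |
  forall e : Gamma E,
    happly eta e = rho a (happly eps e) - happly eps (lm_conn a e)]).
apply: tensorial_Hom; [exact: lm_loc | exact: triv_sheaf | |].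
  move=> c e e'; rewrite (lm_linear a) !happly_linear rho_linear.
  by rewrite scalerBr opprD addrACA.
move=> f e; rewrite happlyZ rho_leibniz lm_leibniz (linfunD (happly_linear eps)).
rewrite !happlyZ (linfunB (fscale_linear f)) opprD addrACA.
rewrite [X in X + _](_ : _ = 0) ?add0r//.
apply: Gamma_ext => x /=.
by rewrite -[LHS]/(_ * (eps x (e x) : K) - _ * (eps x (e x) : K)) subrr.
Qed.

Lemma dual_ext eps eps' : (forall e, happly eps e = happly eps' e) -> eps = eps'.
Proof. exact: Hom_ext lm_loc. Qed.

Lemma happly_lin_l (F G : family k M) (s : Gamma F) :
  linear (fun h : Gamma (Hom F G) => happly h s).
Proof. by move=> c h h'; apply: Gamma_ext. Qed.

Lemma happlyZ_l (F G : family k M) (h : Gamma (Hom F G)) (s : Gamma F) f :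
  happly (fscale f h) s = fscale f (happly h s).
Proof. exact: Gamma_ext. Qed.

Lemma fscale_linear_l (F : family k M) (s : Gamma F) : linear (fun f => fscale f s).
Proof.
by move=> c f g; apply: Gamma_ext => x; rewrite /= scalerDl -scalerA.
Qed.

Lemma dual_conn_linear a : linear (dual_conn (E := E) a).
Proof.
move=> c eps eps'; apply: dual_ext => e.
rewrite happly_lin_l !dual_connE !happly_lin_l rho_linear.
by rewrite scalerBr opprD addrACA.
Qed.

Lemma dual_conn_linear_l eps : linear (fun a => dual_conn (E := E) a eps).
Proof.
move=> c a b; apply: dual_ext => e.
rewrite happly_lin_l !dual_connE lm_linear_l happly_linear rho_linear_l.
by rewrite scalerBr opprD addrACA.
Qed.

Lemma dual_conn_fscale f a eps :
  dual_conn (E := E) (fscale f a) eps = fscale f (dual_conn a eps).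
Proof.
apply: dual_ext => e; rewrite happlyZ_l !dual_connE lm_fscale rho_fscale happlyZ.
by rewrite (linfunB (fscale_linear f)).
Qed.

Lemma dual_conn_leibniz f a eps :
  dual_conn (E := E) a (fscale f eps) = fscale (rho a f) eps + fscale f (dual_conn a eps).
Proof.
apply: dual_ext => e; rewrite (linfunD (happly_lin_l _)) !happlyZ_l !dual_connE.
by rewrite !happlyZ_l rho_leibniz (linfunB (fscale_linear f)) addrA.
Qed.

Lemma dual_conn_flat a b eps :
  dual_conn (E := E) a (dual_conn b eps) - dual_conn b (dual_conn a eps) =
  dual_conn (bracket a b) eps.
Proof.
apply: dual_ext => e; rewrite (linfunB (happly_lin_l _)) !dual_connE.
rewrite rho_bracket -lm_flat (linfunB (happly_linear _)).
rewrite !(linfunB (rho_linear _)).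
apply: Gamma_ext => x; rewrite !(GammaD, GammaN). ring.
Qed.

End DualAction.

(** * The action on linear maps vanishing on A *)

Section HomQConnection.
Variables (R : realType) (k : scalars) (M : manifold R) (P : lie_pair k M).
Local Notation K := (scal R k).
Local Notation L := (lp_L P).
Local Notation A := (lp_A P).
Local Notation inc := (lp_inc P).
Local Notation Cinf := (Cinf k M).
Implicit Types (a b : Gamma A) (l : Gamma L) (f : Cinf).

Lemma rho_inc a f : rho (bm_sec inc a) f = rho a f.
Proof. by apply: Gamma_ext => x; rewrite !rhoE /= lp_anchor. Qed.

Lemma bm_sec_linear (F G : family k M) (h : bmap F G) : linear (bm_sec h).
Proof. by move=> c s t; apply: Gamma_ext => x; rewrite /= linearP. Qed.

Lemma bm_secZ (F G : family k M) (h : bmap F G) f s :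
  bm_sec h (fscale f s) = fscale f (bm_sec h s).
Proof. by apply: Gamma_ext => x; rewrite /= linearZ. Qed.

Variables (F : family k M) (nF : Gamma A -> Gamma F -> Gamma F).
Hypothesis shF : is_sheaf F.
Hypothesis nF_conn : is_connection nF.

Definition qapply (h : Gamma (HomQ P F)) l : Gamma F :=
  happly (bm_sec (HomQ_inc P F) h) l.

Lemma qapply_ext h h' : (forall l, qapply h l = qapply h' l) -> h = h'.
Proof.
move=> hh; apply: HomQ_ext => l x.
by have := congr1 (fun s : Gamma F => s x) (hh l).
Qed.

Lemma qapply_inc h a : qapply h (bm_sec inc a) = 0.
Proof. by apply: Gamma_ext => x; exact: ahom0. Qed.

Lemma qapply_linear h : linear (qapply h). Proof. exact: happly_linear. Qed.
Lemma qapplyZ h f l : qapply h (fscale f l) = fscale f (qapply h l).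
Proof. exact: happlyZ. Qed.
Lemma qapply_linear_l l : linear (qapply^~ l).
Proof. by move=> c h h'; apply: Gamma_ext. Qed.
Lemma qapplyZ_l h f l : qapply (fscale f h) l = fscale f (qapply h l).
Proof. exact: Gamma_ext. Qed.

(** The terms in rho(a)(f) cancel, so the right-hand side is tensorial in l.
It vanishes on A because h does and A is closed under the bracket. *)
Lemma HomQ_conn_exists a h : exists h' : Gamma (HomQ P F), forall l,
  qapply h' l = nF a (qapply h l) - qapply h (bracket (bm_sec inc a) l).
Proof.
have [linl lin Zl leib] := nF_conn.
have [|| g gE] := @tensorial_Hom _ _ _ L F
  (fun l => nF a (qapply h l) - qapply h (bracket (bm_sec inc a) l)) (la_loc L) shF.
- move=> c l m; rewrite (qapply_linear h) lin (bracketDr (bm_sec inc a)).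
  by rewrite (qapply_linear h) scalerBr opprD addrACA.
- move=> f l; rewrite qapplyZ leib bracket_fscaler (linfunD (qapply_linear h)) !qapplyZ.
  rewrite rho_inc (linfunB (fscale_linear f)).
  by rewrite [X in _ - X]addrC opprD addrACA subrr add0r.
have [|h' h'E] := @HomQ_of_Hom _ _ _ P F g.
  move=> y b; have [s <-] := section_through b (la_loc A).
  rewrite -[g y _]/(happly g (bm_sec inc s) y) gE -lp_bracket !qapply_inc.
  by rewrite (linfun0 (lin a)) subr0.
exists h' => l; rewrite -gE; apply: Gamma_ext => x; exact: h'E.
Qed.

Definition HomQ_conn a h := sval (cid (HomQ_conn_exists a h)).

Lemma HomQ_connE a h l : qapply (HomQ_conn a h) l =
  nF a (qapply h l) - qapply h (bracket (bm_sec inc a) l).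
Proof. by rewrite /HomQ_conn; case: cid. Qed.

Lemma HomQ_conn_connection : is_connection HomQ_conn.
Proof.
have [linl lin Zl leib] := nF_conn.
split.
- move=> h c a b; apply: qapply_ext => l; rewrite qapply_linear_l !HomQ_connE linl.
  rewrite (bm_sec_linear inc) bracketDl (qapply_linear h).
  by rewrite scalerBr opprD addrACA.
- move=> a c h h'; apply: qapply_ext => l; rewrite qapply_linear_l !HomQ_connE.
  rewrite !qapply_linear_l lin.
  by rewrite scalerBr opprD addrACA.
- move=> f a h; apply: qapply_ext => l; rewrite qapplyZ_l !HomQ_connE Zl.
  rewrite bm_secZ bracket_fscalel (linfunB (qapply_linear h)) !qapplyZ qapply_inc.
  by rewrite (linfun0 (fscale_linear _)) subr0 (linfunB (fscale_linear f)).
- move=> f a h; apply: qapply_ext => l.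
  rewrite (linfunD (qapply_linear_l l)) !qapplyZ_l !HomQ_connE !qapplyZ_l leib.
  by rewrite (linfunB (fscale_linear f)) addrA.
Qed.

Lemma HomQ_conn_flat : is_flat nF -> is_flat HomQ_conn.
Proof.
have [linl lin Zl leib] := nF_conn.
move=> flat a b h; apply: qapply_ext => l.
rewrite (linfunB (qapply_linear_l l)) !HomQ_connE !(linfunB (lin _)).
rewrite -flat lp_bracket bracket_derivation (linfunB (qapply_linear h)).
rewrite !opprB addrACA !subrKA [X in _ + X]addrC addrACA.
by rewrite [X in _ + X]addrC.
Qed.

End HomQConnection.

(** * The action on jets *)

Section Jets.
Variables (R : realType) (k : scalars) (M : manifold R) (P : lie_pair k M).
Local Notation K := (scal R k).
Local Notation L := (lp_L P).
Local Notation A := (lp_A P).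
Local Notation inc := (lp_inc P).
Local Notation Cinf := (Cinf k M).
Variable E : lie_module A.
Local Notation J := (jet_bundle E).
Implicit Types (a b : Gamma A) (l : Gamma L) (f : Cinf) (u : Gamma J).
Implicit Types (eps : Gamma (dual E)) (e : Gamma E).

Lemma jetP x (j : jet E x) : is_jet (jet_val j).
Proof. exact: (asboolW (jet_subproof j)). Qed.

Lemma jet_D_linear u : linear (jet_D u).
Proof.
move=> c eps eps'; apply: Gamma_ext => x; have [H _ _] := jetP (u x).
exact: H.
Qed.

Lemma jet_D_inc u a eps :
  happly (jet_D u eps) (bm_sec inc a) = happly (dual_conn a eps) (jet_sec u).
Proof. by apply: Gamma_ext => x; have [_ H _] := jetP (u x); exact: H. Qed.

Lemma jet_D_fscale u f eps l : happly (jet_D u (fscale f eps)) l =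
  fscale f (happly (jet_D u eps) l) + fscale (happly eps (jet_sec u)) (rho l f).
Proof.
apply: Gamma_ext => x; have [_ _ H] := jetP (u x).
by rewrite happlyE /= H.
Qed.

(** Covectors on L are determined by their values on global sections, since
these fill the fibres of L. *)
Lemma jet_ext u v : jet_sec u = jet_sec v ->
  (forall eps l, happly (jet_D u eps) l = happly (jet_D v eps) l) -> u = v.
Proof.
move=> uv Duv; apply: Gamma_ext => x; apply: val_inj.
have : (jet_val (u x)).2 = (jet_val (v x)).2.
  exact: (congr1 (fun s : Gamma E => s x) uv).
have : (jet_val (u x)).1 = (jet_val (v x)).1.
  apply/funext => eps; apply: lin_ext => w.
  have [l <-] := section_through w (la_loc L).
  exact: (congr1 (fun s : Gamma (triv k M) => s x) (Duv eps l)).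
by rewrite /=; case: (jet_val (u x)) (jet_val (v x)) => ? ? [? ?] /= -> ->.
Qed.

Lemma jet_exists e (D : Gamma (dual E) -> Gamma (dual L)) :
  linear D ->
  (forall a eps, happly (D eps) (bm_sec inc a) = happly (dual_conn a eps) e) ->
  (forall f eps l, happly (D (fscale f eps)) l =
    fscale f (happly (D eps) l) + fscale (happly eps e) (rho l f)) ->
  exists u, jet_sec u = e /\ forall eps, jet_D u eps = D eps.
Proof.
move=> linD Dinc DZ.
have jD x : is_jet ((fun eps => D eps x, e x) : (Gamma (dual E) -> dual L x) * E x).
  split=> [c eps eps'|a eps|f eps] /=.
  - by rewrite linD.
  - exact: (congr1 (fun s : Gamma (triv k M) => s x) (Dinc a eps)).
  - apply: lin_ext => w; have [l <-] := section_through w (la_loc L).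
    exact: (congr1 (fun s : Gamma (triv k M) => s x) (DZ f eps l)).
have sJ : secs [set: M] ((fun x => Jet (asboolT (jD x))) : psec J).
  by split=> [|eps]; exact: GammaP.
by exists (mk_sec sJ); split=> [|eps]; apply: Gamma_ext.
Qed.

Lemma jet_sec_linear : linear (@jet_sec _ _ _ P E).
Proof. exact: bm_sec_linear. Qed.
Lemma jet_secZ f u : jet_sec (fscale f u) = fscale f (jet_sec u).
Proof. exact: bm_secZ. Qed.
Lemma jet_D_linear_l eps : linear (fun u => jet_D u eps).
Proof. by move=> c u v; apply: Gamma_ext. Qed.
Lemma jet_DZ f u eps : jet_D (fscale f u) eps = fscale f (jet_D u eps).
Proof. exact: Gamma_ext. Qed.

(** Replacing l by f l produces rho(a)(f) <D(eps), l> from the first term and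
from the bracket, with opposite signs. *)
Lemma jet_derivation_exists a u eps : exists h : Gamma (dual L), forall l,
  happly h l = rho a (happly (jet_D u eps) l)
    - happly (jet_D u (dual_conn a eps)) l
    - happly (jet_D u eps) (bracket (bm_sec inc a) l).
Proof.
apply: tensorial_Hom; [exact: la_loc | exact: triv_sheaf | |].
  move=> c l m; rewrite bracketDr !happly_linear rho_linear.
  by apply: Gamma_ext => x; rewrite !(GammaD, GammaN, GammaZ) /GRing.scale /=; ring.
move=> f l; rewrite !happlyZ bracket_fscaler rho_inc rho_leibniz.
rewrite (linfunD (happly_linear _)) !happlyZ.
by apply: Gamma_ext => x; rewrite !(GammaD, GammaN, fscaleE) /GRing.scale /=; ring.
Qed.

(** Two of the conditions on jets are more than linearity.  The values on A are
right because the dual action is flat and A is closed under the bracket; the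
Leibniz rule in eps holds because rho([a, l]) is the commutator of rho(a) and
rho(l). *)
Lemma jet_action_exists a u : exists v, jet_sec v = lm_conn a (jet_sec u) /\
  forall eps l, happly (jet_D v eps) l = rho a (happly (jet_D u eps) l)
    - happly (jet_D u (dual_conn a eps)) l
    - happly (jet_D u eps) (bracket (bm_sec inc a) l).
Proof.
pose D eps := sval (cid (jet_derivation_exists a u eps)).
have DE eps l : happly (D eps) l = rho a (happly (jet_D u eps) l)
    - happly (jet_D u (dual_conn a eps)) l
    - happly (jet_D u eps) (bracket (bm_sec inc a) l).
  by rewrite /D; case: cid.
have [|||v [ve vD]] := @jet_exists (lm_conn a (jet_sec u)) D.
- move=> c eps eps'; apply: (Hom_ext (la_loc L)) => l.
  rewrite happly_lin_l !DE dual_conn_linear !jet_D_linear !happly_lin_l rho_linear.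
  by apply: Gamma_ext => x; rewrite !(GammaD, GammaN, GammaZ) /GRing.scale /=; ring.
- move=> b eps; rewrite DE -lp_bracket !jet_D_inc -dual_conn_flat.
  rewrite (linfunB (happly_lin_l _)) (dual_connE a (dual_conn b eps)).
  by apply: Gamma_ext => x; rewrite !(GammaD, GammaN); ring.
- move=> f eps l; rewrite !DE dual_conn_leibniz (linfunD (jet_D_linear u)).
  rewrite (linfunD (happly_lin_l _)) !jet_D_fscale dual_connE.
  rewrite (linfunD (rho_linear _)) !rho_leibniz.
  rewrite rho_bracket !rho_inc.
  apply: Gamma_ext => x; rewrite !(GammaD, GammaN, fscaleE) /GRing.scale /=; ring.
by exists v; split=> // eps l; rewrite vD DE.
Qed.

Definition jet_conn a u := sval (cid (jet_action_exists a u)).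

Lemma jet_conn_action : jet_action jet_conn.
Proof. by move=> a u; rewrite /jet_conn; case: cid. Qed.

Lemma jet_conn_sec a u : jet_sec (jet_conn a u) = lm_conn a (jet_sec u).
Proof. by case: (jet_conn_action a u). Qed.

Lemma jet_conn_D a u eps l : happly (jet_D (jet_conn a u) eps) l =
  rho a (happly (jet_D u eps) l) - happly (jet_D u (dual_conn a eps)) l
  - happly (jet_D u eps) (bracket (bm_sec inc a) l).
Proof. by case: (jet_conn_action a u). Qed.

Lemma jet_action_unique nabla : jet_action nabla -> jet_conn = nabla.
Proof.
move=> H; apply/funext => a; apply/funext => u; apply: jet_ext.
  by rewrite jet_conn_sec (H a u).1.
by move=> eps l; rewrite jet_conn_D (H a u).2.
Qed.

Lemma jet_conn_connection : is_connection jet_conn.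
Proof.
split.
- move=> u c a b; apply: jet_ext => [|eps l].
    by rewrite jet_sec_linear !jet_conn_sec lm_linear_l.
  rewrite jet_D_linear_l happly_lin_l !jet_conn_D.
  rewrite dual_conn_linear_l jet_D_linear happly_lin_l rho_linear_l.
  rewrite (bm_sec_linear inc) bracketDl happly_linear.
  by apply: Gamma_ext => x; rewrite !(GammaD, GammaN, GammaZ) /GRing.scale /=; ring.
- move=> a c u v; apply: jet_ext => [|eps l].
    by rewrite !jet_sec_linear !jet_conn_sec jet_sec_linear lm_linear.
  rewrite jet_D_linear_l happly_lin_l !jet_conn_D !jet_D_linear_l !happly_lin_l.
  rewrite rho_linear.
  by apply: Gamma_ext => x; rewrite !(GammaD, GammaN, GammaZ) /GRing.scale /=; ring.
- move=> f a u; apply: jet_ext => [|eps l].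
    by rewrite jet_secZ !jet_conn_sec lm_fscale.
  rewrite jet_DZ happlyZ_l !jet_conn_D dual_conn_fscale jet_D_fscale.
  rewrite bm_secZ bracket_fscalel (linfunB (happly_linear _)) !happlyZ jet_D_inc.
  rewrite rho_fscale.
  by apply: Gamma_ext => x; rewrite !(GammaD, GammaN, fscaleE) /GRing.scale /=; ring.
- move=> f a u; apply: jet_ext => [|eps l].
    by rewrite (linfunD jet_sec_linear) !jet_secZ !jet_conn_sec jet_secZ lm_leibniz.
  rewrite (linfunD (jet_D_linear_l _)) !jet_DZ (linfunD (happly_lin_l _)) !happlyZ_l.
  rewrite !jet_conn_D !jet_DZ !happlyZ_l rho_leibniz.
  by apply: Gamma_ext => x; rewrite !(GammaD, GammaN, fscaleE) /GRing.scale /=; ring.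
Qed.

Lemma jet_conn_flat : is_flat jet_conn.
Proof.
move=> a b u; apply: jet_ext => [|eps l].
  by rewrite (linfunB jet_sec_linear) !jet_conn_sec lm_flat.
rewrite (linfunB (jet_D_linear_l _)) (linfunB (happly_lin_l _)) !jet_conn_D.
rewrite !(linfunB (rho_linear _)) rho_bracket -dual_conn_flat.
rewrite (linfunB (jet_D_linear _)) (linfunB (happly_lin_l _)).
rewrite lp_bracket bracket_derivation (linfunB (happly_linear _)).
by apply: Gamma_ext => x; rewrite !(GammaD, GammaN); ring.
Qed.

End Jets.

(** * The exact sequence of the jet bundle *)

Section JetSequence.
Variables (R : realType) (k : scalars) (M : manifold R) (P : lie_pair k M).
Local Notation K := (scal R k).
Local Notation L := (lp_L P).
Local Notation A := (lp_A P).
Local Notation inc := (lp_inc P).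
Local Notation Cinf := (Cinf k M).
Local Notation triv := (triv k M).
Variable E : lie_module A.
Local Notation J := (jet_bundle E).
Local Notation T := (ann_tensor E).
Implicit Types (a b : Gamma A) (l : Gamma L) (f : Cinf) (u : Gamma J).
Implicit Types (eps : Gamma (dual E)) (e : Gamma E) (psi : Gamma T).

Lemma lin_sum (F0 : fieldType) (V0 W0 : lmodType F0) (I : Type) (r : seq I)
  (h : I -> lin V0 W0) v : (\sum_(i <- r) h i) v = \sum_(i <- r) h i v.
Proof. by apply: (big_morph (fun h : lin V0 W0 => h v)). Qed.

Lemma ahom_sum (F0 : fieldType) (S0 V0 W0 : lmodType F0) (i0 : lin S0 V0) (I : Type)
  (r : seq I) (h : I -> ahom i0 W0) v : (\sum_(i <- r) h i) v = \sum_(i <- r) h i v.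
Proof. by apply: (big_morph (fun h : ahom i0 W0 => h v)). Qed.

Lemma qapply_tens (alpha : Gamma (annihilator P)) e l :
  qapply (tens alpha e) l = fscale (qapply alpha l) e.
Proof. exact: Gamma_ext. Qed.

(** The case of the trivial line bundle in HomQ_conn_exists. *)
Lemma ann_connE a (alpha : Gamma (annihilator P)) l :
  qapply (ann_conn a alpha) l =
    rho a (qapply alpha l) - qapply alpha (bracket (bm_sec inc a) l).
Proof.
move: l; rewrite /ann_conn; apply: (@xgetPex _ 0 [set beta : Gamma (annihilator P) |
  forall l, qapply beta l =
    rho a (qapply alpha l) - qapply alpha (bracket (bm_sec inc a) l)]).
exact: (HomQ_conn_exists (@triv_sheaf R k M) (rho_connection A)).
Qed.

Definition tensor_conn : Gamma A -> Gamma T -> Gamma T :=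
  HomQ_conn (locally_trivial_sheaf (lm_loc E)) (lm_connection E).

Lemma tensor_conn_action : tensor_action tensor_conn.
Proof.
split=> [|a alpha e]; first exact: HomQ_conn_connection.
apply: qapply_ext => l; rewrite (linfunD (qapply_linear_l l)) HomQ_connE.
rewrite !qapply_tens ann_connE lm_leibniz.
by rewrite (linfunB (fscale_linear_l e)) addrAC.
Qed.

Lemma jet_D_breve_f psi eps l :
  happly (jet_D (bm_sec (breve_f E) psi) eps) l = happly eps (qapply psi l).
Proof. exact: Gamma_ext. Qed.

Lemma jet_sec_breve_f psi : jet_sec (bm_sec (breve_f E) psi) = 0.
Proof. exact: Gamma_ext. Qed.

Lemma breve_f_morphism : module_morphism tensor_conn (@jet_conn _ _ _ P E) (breve_f E).
Proof.
move=> a psi; apply: jet_ext => [|eps l].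
  by rewrite jet_conn_sec !jet_sec_breve_f (linfun0 (lm_linear a)).
rewrite jet_conn_D !jet_D_breve_f HomQ_connE dual_connE (linfunB (happly_linear _)).
by apply: Gamma_ext => x; rewrite !(GammaD, GammaN); ring.
Qed.

Lemma breve_g_morphism :
  module_morphism (@jet_conn _ _ _ P E) (lm_conn (l:=E)) (breve_g E).
Proof. by move=> a u; exact: jet_conn_sec. Qed.

Lemma jet_eq x (j j' : jet E x) : (jet_val j).2 = (jet_val j').2 ->
  (forall eps v, (jet_val j).1 eps v = (jet_val j').1 eps v) -> j = j'.
Proof.
move=> e2 e1; apply: val_inj => /=.
have : (jet_val j).1 = (jet_val j').1 by apply/funext => eps; apply: lin_ext.
by move: e2; case: (jet_val j) (jet_val j') => ? ? [? ?] /= -> ->.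
Qed.

Lemma breve_f_inj x : injective (breve_f E x).
Proof.
move=> h h' hh; apply: val_inj; apply: lin_ext => v /=.
have [n [e [c [phi [W [[_ Wx W1] ce _]]]]]] := global_dual_frame x (lm_loc E).
rewrite -[LHS]scale1r -[RHS]scale1r -(W1 x Wx) !ce; apply: eq_bigr => i _.
congr (_ *: _).
exact: (congr1 (fun j : jet E x => (jet_val j).1 (c i) v) hh).
Qed.

(** When e = 0 the derivative term of a jet (D, e) disappears, so D(eps) at x
depends only on the value of eps at x, and it vanishes on A. *)
Lemma breve_f_exact x (j : jet E x) : (jet_val j).2 = 0 -> exists h, breve_f E x h = j.
Proof.
move=> j0; have [linD Dinc DZ] := jetP j; rewrite j0 in Dinc DZ.
have [n [e [c [phi [W [[_ Wx W1] ce _]]]]]] := global_dual_frame x (lm_loc E).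
pose D := (jet_val j).1.
have hl : linear (fun v : L x => \sum_i (D (c i) v : K) *: e i x).
  move=> s u v; rewrite scaler_sumr -big_split; apply: eq_bigr => i _ /=.
  by rewrite linearP /= scalerDl scalerA.
have h0 (b : A x) : \sum_i (D (c i) (inc x b) : K) *: e i x = 0.
  have [s <-] := section_through b (la_loc A).
  by rewrite big1// => i _; rewrite /D Dinc linear0 scale0r.
exists (AHom (asboolT (h0 : forall z : A x, Lin (asboolT hl) (inc x z) = 0))).
apply: jet_eq => [//|eps v] /=.
have pE : fscale phi eps = \sum_i fscale (happly eps (e i)) (c i).
  apply: (Hom_ext (lm_loc E)) => s; apply: Gamma_ext => y.
  rewrite !happlyE Gamma_sum lin_sum.
  transitivity (eps y (phi y *: s y)); first by rewrite linearZ.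
  rewrite ce linear_sum.
  by apply: eq_bigr => i _; rewrite linearZ /= [LHS]mulrC.
have D0 : D 0 = 0 by exact: (linfun0 linD).
have DD : {morph D : u v / u + v} by exact: (linfunD linD).
have DZ' f eta : D (fscale f eta) = f x *: D eta.
  by rewrite /D DZ linear0 scale0r addr0.
have -> : (jet_val j).1 eps = D (fscale phi eps) by rewrite DZ' W1// scale1r.
rewrite pE (big_morph D DD D0) linear_sum lin_sum.
by apply: eq_bigr => i _; rewrite DZ' linearZ /= [LHS]mulrC.
Qed.

(** The operator N plays the role of l |-> f nabla_l e for an extension of the
A-action to L.  The jet is D(eps)(l) = f rho(l)<eps, e> - <eps, N(l)>, which
on A is f <nabla_b eps, e> by the definition of the dual action. *)
Lemma jet_of_partial_connection f e (N : Gamma L -> Gamma E) :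
  linear N -> (forall g l, N (fscale g l) = fscale g (N l)) ->
  (forall b, N (bm_sec inc b) = fscale f (lm_conn b e)) ->
  exists u, jet_sec u = fscale f e.
Proof.
move=> linN NZ Ninc.
have H eps : exists h : Gamma (dual L), forall l,
    happly h l = fscale f (rho l (happly eps e)) - happly eps (N l).
  apply: tensorial_Hom; [exact: la_loc | exact: triv_sheaf | |].
    move=> c l m; rewrite linN happly_linear rho_linear_l fscale_linear.
    by rewrite scalerBr opprD addrACA.
  move=> g l; rewrite NZ happlyZ rho_fscale.
  by apply: Gamma_ext => x; rewrite !(GammaD, GammaN, fscaleE) /GRing.scale /=; ring.
pose D eps := sval (cid (H eps)).
have DE eps l : happly (D eps) l = fscale f (rho l (happly eps e)) - happly eps (N l).
  by rewrite /D; case: cid.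
have [|||u [ue _]] := @jet_exists _ _ _ _ E (fscale f e) D; last by exists u.
- move=> c eps eps'; apply: (Hom_ext (la_loc L)) => l.
  rewrite happly_lin_l !DE !happly_lin_l rho_linear fscale_linear.
  by rewrite scalerBr opprD addrACA.
- move=> a eps; rewrite DE Ninc rho_inc !happlyZ dual_connE.
  by rewrite (linfunB (fscale_linear f)).
- move=> g eps l; rewrite !DE !happlyZ_l rho_leibniz happlyZ.
  by apply: Gamma_ext => x; rewrite !(GammaD, GammaN, fscaleE) /GRing.scale /=; ring.
Qed.

(** The forms alp of adapted_frame extend the action from A to L by
N(s) = sum_i <alp_i, s> nabla_{a_i} e; on A this is nabla_{phi b} e. *)
Lemma jet_lift x : exists (phi : Cinf) W,
  [/\ open W, W x, forall y, W y -> phi y = 1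
    & forall e, exists u, jet_sec u = fscale phi e].
Proof.
have [p [q [a [alp [l [lam [phi [W [[oW Wx W1] aE _ _]]]]]]]]] := adapted_frame P x.
exists phi, W; split=> // e.
pose N s := \sum_i fscale (happly (alp i) s) (lm_conn (a i) e).
apply: (@jet_of_partial_connection phi e N).
- move=> c s t; rewrite scaler_sumr -big_split; apply: eq_bigr => i _ /=.
  by rewrite happly_linear fscale_linear_l.
- move=> g s; apply: Gamma_ext => y; rewrite /= !Gamma_sum scaler_sumr.
  by apply: eq_bigr => i _; rewrite happlyZ /= scalerA.
- move=> b; rewrite -lm_fscale.
  have -> : fscale phi b = \sum_i fscale (happly (alp i) (bm_sec inc b)) (a i).
    by apply: Gamma_ext => y; rewrite Gamma_sum /= aE.
  have l0 := linfun0 (lm_linear_l e); have lD := linfunD (lm_linear_l e).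
  rewrite (big_morph (fun a => lm_conn a e) lD l0).
  by apply: eq_bigr => i _; rewrite lm_fscale.
Qed.

Lemma breve_exact : short_exact (breve_f E) (breve_g E).
Proof.
move=> x; split; first exact: breve_f_inj.
  move=> j; split=> [|[h <-] //]; exact: breve_f_exact.
move=> w; have [phi [W [_ Wx W1 lift]]] := jet_lift x.
have [e <-] := section_through w (lm_loc E).
have [u ue] := lift e; exists (u x).
have := congr1 (fun s : Gamma E => s x) ue.
by rewrite /= W1// scale1r.
Qed.

(** The frame is lambda_j (x) e_m, with coordinates h |-> <c_m, h(l_j)>. *)
Lemma tensor_dual_frame x : exists W q m (t : 'I_q * 'I_m -> Gamma T)
    (l : 'I_q -> Gamma L) (e : 'I_m -> Gamma E) (c : 'I_m -> Gamma (dual E)),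
  [/\ open W, W x, forall y, W y -> forall h : T y,
        h = \sum_i (c i.2 y (h (l i.1 y)) : K) *: t i y,
      forall y, W y -> forall i j, c i.2 y (t j y (l i.1 y)) = (i == j)%:R :> K
    & (forall y, W y -> forall v : E y, v = \sum_i (c i y v : K) *: e i y) /\
      (forall y, W y -> forall i j, c i y (e j y) = (i == j)%:R :> K)].
Proof.
have [p [q [a [alp [l [lam [_ [U [[oU Ux _] _ span ll]]]]]]]]] := adapted_frame P x.
have [m [e [c [phi [V [[oV Vx V1] ce cd]]]]]] := global_dual_frame x (lm_loc E).
have ce' y : V y -> forall v : E y, v = \sum_i (c i y v : K) *: e i y.
  by move=> Vy v; rewrite -ce V1// scale1r.
exists (U `&` V), q, m, (fun i => tens (lam i.1) (e i.2)), l, e, c.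
split=> //; first exact: openI; last by split=> y [_ Vy]; [exact: ce'|exact: cd].
- move=> y [Uy Vy] h; apply: val_inj; apply: lin_ext => v /=.
  have [b vE] := span y Uy v.
  rewrite {1}vE linearD /= ahom0 add0r linear_sum ahom_sum.
  transitivity (\sum_i \sum_j
      (c j y (h (l i y)) : K) *: ((lam i y v : K) *: e j y)).
    apply: eq_bigr => i _; rewrite linearZ /= {1}(ce' y Vy (h (l i y))) scaler_sumr.
    by apply: eq_bigr => j _; rewrite !scalerA mulrC.
  rewrite pair_bigA /=; exact: eq_bigr.
- move=> y [Uy Vy] [i i'] [j j'] /=.
  by rewrite linearZ /= ll// cd// -[LHS]/(_ * _) xpair_eqE -natrM mulnb (eq_sym j).
Qed.

Lemma tensor_locally_trivial : locally_trivial T.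
Proof.
apply: locally_trivial_of_dual_frames => [|x].
  exact: HomQ_sheaf (locally_trivial_sheaf (lm_loc E)).
have [W [q [m [t [l [e [c [oW Wx tE td _]]]]]]]] := tensor_dual_frame x.
have dl (i : 'I_q * 'I_m) y : linear (fun h : T y => c i.2 y (h (l i.1 y)) : K^o).
  by move=> s h h'; rewrite -[X in c i.2 y X]/(s *: h _ + h' _) linearP.
exists W, ('I_q * 'I_m)%type, (fun i => t i).
exists (fun i y => Lin (asboolT (dl i y))); split=> //; split.
- by move=> i; apply: secsW (GammaP (t i)).
- move=> i V h oV VW sh.
  apply: (GammaP (c i.2)) => //; apply: sh => //.
  by apply: secsW (GammaP (l i.1)).
- by move=> y Wy h; exact: tE.
- by move=> y Wy i j; exact: td.
Qed.

Lemma jet_sheaf : is_sheaf J.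
Proof.
have shE := locally_trivial_sheaf (lm_loc E).
move=> U s oU H; split=> [|eps].
  apply: shE => // x /H[W [t [oW Wx [st _] ts]]].
  by exists W, (fun y => (jet_val (t y)).2); split=> // y /ts ->.
apply: (Hom_sheaf (F := L) (@triv_sheaf R k M)) => // x /H[W [t [oW Wx [_ st] ts]]].
exists W, ((fun y => (jet_val (t y)).1 eps) : psec (dual L)); split=> //.
by move=> y /ts ->.
Qed.

Lemma jet_eval_linear x eps (v : L x) :
  linear (fun j : J x => (jet_val j).1 eps v : K^o).
Proof.
move=> s j j'.
have -> : jet_val (s *: j + j') = s *: jet_val j + jet_val j' by [].
by transitivity ((s *: (jet_val j).1 eps + (jet_val j').1 eps) v).
Qed.

(** The frame consists of the images under breve_f of a frame of
A^perp (x) E and of jets j_m lifting a frame e_m of E.  The coordinates of a jet v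
along the j_m are those of its value in E; subtracting the combination of the j_m
leaves a jet with value 0, an image under breve_f by exactness, and its
coordinates are read off by evaluating D on c_m and l_j. *)
Lemma jet_locally_trivial : locally_trivial J.
Proof.
apply: locally_trivial_of_dual_frames => [|x]; first exact: jet_sheaf.
have [W0 [q [m [t [l [e [c [oW0 W0x tE td [ce cd]]]]]]]]] := tensor_dual_frame x.
have [phi [W1 [oW1 W1x phi1 lift]]] := jet_lift x.
pose W := W0 `&` W1.
pose j n := sval (cid (lift (e n))).
have jE n y : W1 y -> (jet_val (j n y)).2 = e n y.
  move=> /phi1 p1; rewrite /j; case: cid => u /= ue.
  have := congr1 (fun s : Gamma E => s y) ue.
  by rewrite /= p1 scale1r.
have d0l (i : 'I_q * 'I_m) y :
    linear (fun v : J y => (jet_val v).1 (c i.2) (l i.1 y) : K^o).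
  exact: jet_eval_linear.
pose d0 i y := Lin (asboolT (d0l i y)).
pose d (i : 'I_q * 'I_m + 'I_m) y (v : J y) : K^o :=
  match i with
  | inl i => (d0 i y v : K) - \sum_n (c n y (jet_val v).2 : K) * (d0 i y (j n y) : K)
  | inr n => c n y (jet_val v).2
  end.
have dl i y : linear (d i y).
  case: i => [i|n] s v v'; last by rewrite /= linearP.
  rewrite /d linearP.
  rewrite scalerBr addrACA -opprD; congr (_ - _).
  rewrite scaler_sumr -big_split; apply: eq_bigr => n _ /=.
  by rewrite linearP mulrDl; congr (_ + _); rewrite /GRing.scale /= mulrA.
pose g (i : 'I_q * 'I_m + 'I_m) : Gamma J :=
  match i with inl i => bm_sec (breve_f E) (t i) | inr n => j n end.
exists W, ('I_q * 'I_m + 'I_m)%type, (fun i => g i), (fun i y => Lin (asboolT (dl i y))).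
have oW : open W by exact: openI.
split=> //; split.
- by move=> i; apply: secsW (GammaP (g i)).
- move=> i V s oV VW [s2 s1] /=.
  have s0 i' (u : psec J) : secs V u -> smooth_fun V (fun y => d0 i' y (u y)).
    move=> [_ u1]; apply: (u1 (c i'.2)) => //.
    by apply: secsW (GammaP (l i'.1)).
  have sc n : smooth_fun V (fun y => c n y (jet_val (s y)).2 : K).
    exact: (GammaP (c n)).
  case: i => [i|n]; last exact: sc.
  apply: smooth_funD => //; first exact: s0.
  apply: smooth_funN => //; apply: smooth_fun_sum => // n.
  apply: smooth_funM => //; apply: s0.
  by apply: secsW (GammaP (j n)).
- move=> y [W0y W1y] v; rewrite big_sumType /=.
  pose w := \sum_n (c n y (jet_val v).2 : K) *: (j n y : J y).
  have [h hE] : exists h, breve_f E y h = v - w.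
    apply: breve_f_exact; rewrite -[LHS]/(breve_g E y (v - w)) linearB linear_sum.
    rewrite /= {1}(ce y W0y (jet_val v).2) -sumrB big1// => n _.
    by rewrite linearZ /= jE// scalerN subrr.
  have dE i : d (inl i) y v = c i.2 y (h (l i.1 y)).
    transitivity (d0 i y (v - w)); last by rewrite -hE.
    have -> : d0 i y (v - w) = d0 i y v - d0 i y w by rewrite linearB.
    rewrite /d /w; congr (_ - _).
    rewrite linear_sum; apply: eq_bigr => n _.
    by rewrite linearZ.
  rewrite -[LHS](subrK w) -hE; congr (_ + _).
  rewrite {1}(tE y W0y h) linear_sum; apply: eq_bigr => i _.
  by rewrite linearZ -dE.
- move=> y [W0y W1y] [i|n] [i'|n'] /=.
  + rewrite td// big1 ?subr0// => n _.
    by rewrite linear0 mul0r.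
  + apply/eqP; rewrite subr_eq0; apply/eqP.
    rewrite (bigD1 n')//= jE// cd// eqxx mul1r big1 ?addr0// => n nn'.
    by rewrite cd// (negbTE nn') mul0r.
  + by rewrite linear0.
  + by rewrite jE// cd.
Qed.

End JetSequence.

Theorem theoremA (R : realType) (k : scalars) (M : manifold R)
    (P : lie_pair k M) (E : lie_module (lp_A P)) :
  exists (nT : Gamma (lp_A P) -> Gamma (ann_tensor E) -> Gamma (ann_tensor E))
         (nJ : Gamma (lp_A P) -> Gamma (jet_bundle E) -> Gamma (jet_bundle E)),
    [/\ tensor_action nT /\ is_module nT,
        unique (@jet_action R k M P E) nJ,
        is_module nJ,
        module_morphism nT nJ (breve_f E) /\
        module_morphism nJ (lm_conn (l:=E)) (breve_g E)
      & short_exact (breve_f E) (breve_g E)].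
Proof.
exists (tensor_conn (E := E)), (jet_conn (E := E)); split.
- split; first exact: tensor_conn_action.
  split; [exact: tensor_locally_trivial | by case: (tensor_conn_action E) |].
  exact/HomQ_conn_flat/lm_flat.
- by split; [exact: jet_conn_action | exact: jet_action_unique].
- split; [exact: jet_locally_trivial | exact: jet_conn_connection |].
  exact: jet_conn_flat.
- by split; [exact: breve_f_morphism | exact: breve_g_morphism].
- exact: breve_exact.
Qed.
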